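(* Let $f:X\to X$ be the endomorphism of the compact abelian group $X=\widehat{\mathbb{Z}[\frac13]}$ dual to the map $\phi:x\mapsto 2x$ on the (discrete) additive group $\mathbb{Z}[\frac13]$, and let $$\zeta(z)=\exp\sum_{n=1}^{\infty}\frac{z^n}{n}\,\mathcal{F}_n(f),\qquad \mathcal{F}_n(f)=\#\{x\in X : f^n x=x\},$$ be its dynamical zeta function. Then $\zeta$ has the circle $|z|=\frac12$ as natural boundary.
   Context: $\mathbb{Z}[\frac13]$ is the ring of rationals whose denominator is a power of $3$. Its additive group is given the discrete topology, and $X=\widehat{\mathbb{Z}[\frac13]}$ is its Pontryagin dual (the compact group of characters $\chi:\mathbb{Z}[\frac13]\to S^1$). The dual map is $f=\widehat{\phi}$, $f(\chi)=\chi\circ\phi$, where $\phi(x)=2x$. The numbers $\mathcal{F}_n(f)$ are finite for all $n\ge 1$, and the series defining $\zeta$ has radius of convergence $\frac12$. That the circle $|z|=\frac12$ is a natural boundary for $\zeta$ means that $\zeta$, analytic on $|z|<\frac12$, admits no analytic continuation to a neighbourhood of any point of the circle $|z|=\frac12$. *)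

(* Defs.v *)
(* The complex numbers are R[i], for an arbitrary R : realType. *)
From HB Require Import structures.
From mathcomp Require Import all_boot all_order all_algebra finmap complex.
From mathcomp Require Import all_classical all_reals all_analysis.

Set Implicit Arguments.
Unset Strict Implicit.
Unset Printing Implicit Defensive.

Import Order.TTheory GRing.Theory Num.Theory.
Import numFieldNormedType.Exports.

Local Open Scope classical_set_scope.
Local Open Scope ring_scope.
Local Open Scope complex_scope.

(* The norm topology of R[i]. *)
HB.instance Definition _ (R : realType) := NormedModule.copy R[i] R[i]^o.

(* Rationals whose reduced denominator is a power of 3. *)
Definition is_Zthird : {pred rat} := [pred x : rat | (3%N).-nat `|denq x|%N].

Lemma is_ZthirdP (x : rat) :
  reflect (exists k, x * 3%:R ^+ k \is a Num.int) (x \in is_Zthird).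
Proof.
apply: (iffP idP) => [|[k]].
  rewrite inE => /p_natP[k dk]; exists k; rewrite -{1}(divq_num_den x).
  have -> : (denq x)%:~R = 3%:R ^+ k :> rat.
    by rewrite -(gez0_abs (denq_ge0 x)) dk -pmulrn natrX.
  by rewrite mulfVK ?expf_neq0.
move=> /intrP[m xm]; rewrite inE.
have -> : x = fracq (m, Posz (3 ^ k)).
  by rewrite fracqE /= -xm -pmulrn natrX mulfK ?expf_neq0.
have d3 : (`|denq (fracq (m, Posz (3 ^ k)))| %| 3 ^ k)%N.
  rewrite den_fracq /=; case: ifP => _; last exact: dvd1n.
  by rewrite absz_nat dvdn_div ?dvdn_gcdr.
by rewrite (pnat_dvd d3) // pnatX pnat_id.
Qed.

Lemma Zthird_subring_closed : subring_closed is_Zthird.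
Proof.
split=> [|x y /is_ZthirdP[k xk] /is_ZthirdP[l yl]
        |x y /is_ZthirdP[k xk] /is_ZthirdP[l yl]].
- by apply/is_ZthirdP; exists 0%N; rewrite mulr1 rpred1.
- apply/is_ZthirdP; exists (k + l)%N.
  rewrite mulrBl {1}exprD mulrA (addnC k) exprD [y * _]mulrA.
  by rewrite rpredB // rpredM // rpredX.
- apply/is_ZthirdP; exists (k + l)%N.
  by rewrite exprD mulrACA rpredM.
Qed.

HB.instance Definition _ :=
  GRing.isSubringClosed.Build rat is_Zthird Zthird_subring_closed.

Definition Zthird : Type := {x : rat | x \in is_Zthird}.
HB.instance Definition _ := SubChoice.on Zthird.
HB.instance Definition _ := [SubChoice_isSubComNzRing of Zthird by <:].

Definition mul2 (x : Zthird) : Zthird := 2%:R * x.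

Lemma mul2_is_additive : zmod_morphism mul2.
Proof. by move=> x y; rewrite /mul2 mulrBr. Qed.

HB.instance Definition _ :=
  GRing.isZmodMorphism.Build Zthird Zthird mul2 mul2_is_additive.

Section PontryaginDual.
Variable R : realType.

(* The characters G -> S^1 of a discrete abelian group G: continuity is then
   automatic.  Only the underlying set of the dual is needed to count points. *)
Record dual (G : zmodType) := Character {
  char_fun :> G -> R[i];
  charD : forall x y, char_fun (x + y) = char_fun x * char_fun y;
  char_norm : forall x, `|char_fun x| = 1 }.

HB.instance Definition _ (G : zmodType) := gen_eqMixin (dual G).
HB.instance Definition _ (G : zmodType) := gen_choiceMixin (dual G).

Variables (G H : zmodType) (phi : {additive G -> H}) (chi : dual H).

Lemma dual_mapD x y : chi (phi (x + y)) = chi (phi x) * chi (phi y).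
Proof. by rewrite raddfD charD. Qed.

Definition dual_map : dual G :=
  @Character G (fun x => chi (phi x)) dual_mapD (fun x => char_norm chi (phi x)).

End PontryaginDual.

Section Zeta.
Variable R : realType.
Local Notation C := R[i].

Definition fixed_points (X : choiceType) (f : X -> X) (n : nat) : set X :=
  [set x | iter n f x = x].

(* Meaningful when [fixed_points f n] is finite ([fset_set] is empty
   otherwise). *)
Definition num_fixed_points (X : choiceType) (f : X -> X) (n : nat) : nat :=
  #|` fset_set (fixed_points f n)|.

Definition cexp (z : C) : C := limn (series (fun n => z ^+ n / n`!%:R)).

Definition dynamical_zeta (X : choiceType) (f : X -> X) (z : C) : C :=
  cexp (limn (fun N =>
    \sum_(1 <= n < N) z ^+ n / n%:R * (num_fixed_points f n)%:R)).

Definition analytic_at (g : C -> C) (a : C) : Prop :=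
  exists c : nat -> C,
    \forall z \near a, series (fun n => c n * (z - a) ^+ n) @ \oo --> g z.

Definition analytic_on (A : set C) (g : C -> C) : Prop :=
  forall a, A a -> analytic_at g a.

Definition natural_boundary (g : C -> C) (r : R) : Prop :=
  analytic_on [set z | `|z| < r%:C] g /\
  forall p : C, `|p| = r%:C ->
    ~ exists (U : set C) (h : C -> C),
        [/\ open U, U p, analytic_on U h &
            forall z, U z -> `|z| < r%:C -> h z = g z].

End Zeta.

(* Main.v *)
Require Import Defs.
From mathcomp Require Import all_boot all_order all_algebra finmap complex.
From mathcomp Require Import all_classical all_reals all_analysis.
From mathcomp Require Import cyclic separable cyclotomic.
From mathcomp Require Import ring lra zify.
Set Implicit Arguments.
Unset Strict Implicit.
Unset Printing Implicit Defensive.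
Import Order.TTheory GRing.Theory Num.Theory.
Import numFieldNormedType.Exports.
Local Open Scope classical_set_scope.
Local Open Scope ring_scope.
Import ComplexField.Normc.

(** The characters fixed by the [n]-th iterate are those trivial on the
    multiples of [2 ^ n - 1]. Since 3 is invertible in the group, there are as
    many of them as the part of [2 ^ n - 1] prime to 3, that is
    [(2 ^ n - 1) * w n] with [w n] the 3-adic absolute value of [2 ^ n - 1]
    ([num_fixed_dual_mul2]). Moreover [3 ^ i.+1] divides [2 ^ n - 1] if and only
    if [2 * 3 ^ i] divides [n] ([dvdn_exp2B1]), so that [w] is an infinite
    combination of indicators of multiples:
    [w n = 1 - sum_i (2 / 3 ^ i.+1) [2 * 3 ^ i divides n]].

    Let [eta] be a root of unity of order [3 ^ j], [j > 0], and let
    [z = t eta / 2] with [t] in [(0, 1)]. Up to a bounded term, [log (zeta z)]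
    is the sum of [t ^ n eta ^ n w n / n]. The constant 1 and the indicators
    with [i < j] contribute a bounded amount, by Abel summation, because [eta]
    and [eta ^ (2 * 3 ^ i)] differ from 1. What is left of [w] is negative and
    supported on the multiples of [2 * 3 ^ j], where [eta ^ n = 1]: it
    contributes at most a negative multiple of the sum of [t ^ n / n] over these
    multiples, which diverges when [t] tends to 1. Hence the real part of the
    logarithm tends to [-oo], and [zeta] tends to 0 along the radius that ends
    at [eta / 2] ([zeta_radial_limit]).

    The points [eta / 2] are dense in the circle ([root3_dense]). If [zeta] had
    an analytic extension near a point of the circle, this extension would
    vanish, by continuity, at all the nearby [eta / 2]; each of these is a limit
    of others, so it would be zero on an open set meeting the disc
    ([analytic_locally_zero]), where [zeta] is an exponential and does not
    vanish ([zeta_neq0]).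

    Analyticity inside the disc is obtained without complex differentiation:
    absolutely summable double series can be summed in either order
    ([fubini_series]), which gives the power series of the exponential of a
    power series ([cvg_exp_compose]) and the expansion of a power series at
    another point of its disc ([analytic_at_recenter]). *)

(** * Limits and the modulus of complex numbers *)

Local Notation normc := (@ComplexField.Normc.normc _).

Section ComplexLimits.
Variable R : realType.
Local Notation C := R[i].
Implicit Types (u v : nat -> C) (z l : C).
Local Open Scope complex_scope.

Lemma norm_normc z : `|z| = (normc z)%:C. Proof. by []. Qed.

Lemma normc_ge0 z : 0 <= normc z.
Proof. by rewrite -lecR -norm_normc normr_ge0. Qed.

Lemma normc_gt0 z : (0 < normc z) = (z != 0).
Proof. by rewrite -ltcR -norm_normc normr_gt0. Qed.

Lemma normc_le0_eq0 z : normc z <= 0 -> z = 0.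
Proof. by move=> z0; apply/eqP; rewrite -normr_le0 norm_normc lecR. Qed.

Lemma normcB z l : normc (z - l) = normc (l - z).
Proof. by apply: complexI; rewrite -!norm_normc distrC. Qed.

Lemma ler_normcD z l : normc (z + l) <= normc z + normc l.
Proof. by rewrite -lecR rmorphD /= -!norm_normc ler_normD. Qed.

Lemma normcN z : normc (- z) = normc z.
Proof. by rewrite -(subr0 z) opprB normcB. Qed.

Lemma normc_real (x : R) : normc x%:C = `|x|.
Proof. by rewrite /= expr0n addr0 sqrtr_sqr. Qed.

Lemma normc_nat n : normc (n%:R : C) = n%:R.
Proof. by rewrite -(rmorph_nat (@real_complex R)) normc_real normr_nat. Qed.

Lemma normcX z n : normc (z ^+ n) = normc z ^+ n.
Proof. by apply: complexI; rewrite -norm_normc normrX rmorphXn. Qed.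

Lemma normc_unity_root z n : (0 < n)%N -> z ^+ n = 1 -> normc z = 1.
Proof.
move=> n0 zn; apply/eqP.
by rewrite -(@pexpr_eq1 _ _ n) ?normc_ge0// -normcX zn normc1.
Qed.

Lemma normc_sum (I : Type) (r : seq I) (P : pred I) (F : I -> C) :
  normc (\sum_(i <- r | P i) F i) <= \sum_(i <- r | P i) normc (F i).
Proof.
rewrite -lecR -norm_normc (le_trans (ler_norm_sum _ _ _))//.
by rewrite rmorph_sum.
Qed.

Lemma normc_Re z : `|complex.Re z| <= normc z.
Proof. by rewrite -lecR; exact: normc_ge_Re. Qed.

Lemma normc_Im z : `|complex.Im z| <= normc z.
Proof.
by case: z => x y /=; rewrite -(sqrtr_sqr y) ler_wsqrtr // lerDr sqr_ge0.
Qed.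

Lemma normc_le_Re_Im (x y : R) : normc (x +i* y) <= `|x| + `|y|.
Proof.
rewrite -lecR -norm_normc (complexE (x +i* y)) /= (le_trans (ler_normD _ _))//.
rewrite normrM rmorphD /= lerD //.
  by rewrite norm_normc normc_real.
rewrite (_ : `|'i%C| = 1) ?mul1r; first by rewrite norm_normc normc_real.
by rewrite norm_normc /= expr0n expr1n add0r sqrtr1.
Qed.

(** The norm of [R[i]] takes its values in [R[i]]; this and [nearcP] allow real
    radii. *)
Lemma cvgcP u l : u @ \oo --> l <-> forall e : R, 0 < e ->
  exists N, forall n, (N <= n)%N -> normc (l - u n) < e.
Proof.
split=> [/cvgrPdist_lt ul e e0|ul].
  have /ul : (0 : C) < e%:C by rewrite ltcR.
  by move=> [N _ Nu]; exists N => n /Nu; rewrite norm_normc ltcR.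
apply/cvgrPdist_lt => e e0.
have er : e = (complex.Re e)%:C by rewrite RRe_real// gtr0_real.
move: e0; rewrite er ltcR => /ul[N Nu].
by exists N => // n /Nu; rewrite /= norm_normc ltcR.
Qed.

Lemma nearcP (a : C) (P : C -> Prop) : (\forall z \near a, P z) <->
  exists2 d : R, 0 < d & forall z, normc (z - a) < d -> P z.
Proof.
split=> [/nbhs_ballP[e e0 eP]|[d d0 dP]].
  have er : e = (complex.Re e)%:C by rewrite RRe_real// gtr0_real.
  exists (complex.Re e); first by rewrite -ltcR -er.
  by move=> z za; apply: eP; rewrite /ball /= er norm_normc ltcR normcB.
apply/nbhs_ballP; exists d%:C; first by rewrite /= ltcR.
move=> z; rewrite /ball /= norm_normc ltcR => za; apply: dP.
by rewrite normcB.
Qed.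

End ComplexLimits.

(** * Absolutely convergent series and double series *)

Section ComplexSeries.
Variable R : realType.
Local Notation C := R[i].
Implicit Types (u v : nat -> C) (z l : C).
Local Open Scope complex_scope.

Lemma cvg_Re u l : u @ \oo --> l ->
  (fun n => complex.Re (u n)) @ \oo --> complex.Re l.
Proof.
move=> /cvgcP ul; apply/cvgrPdist_lt => e /ul[N Nu].
exists N => // n /Nu; apply: le_lt_trans.
by rewrite -raddfB; exact: normc_Re.
Qed.

Lemma cvg_normc u l : u @ \oo --> l ->
  (fun n => normc (u n)) @ \oo --> normc l.
Proof. by move=> ul; exact: (cvg_Re (cvg_norm ul)). Qed.

Lemma normc_lim_le u l (M : R) N : u @ \oo --> l ->
  (forall n, (N <= n)%N -> normc (u n) <= M) -> normc l <= M.
Proof.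
by move=> /cvg_normc ul uM; apply: (cvgr_to_le ul); exists N.
Qed.

Lemma cvg_uniq u l l' : u @ \oo --> l -> u @ \oo --> l' -> l = l'.
Proof. by move=> ul ul'; rewrite -(cvg_lim _ ul) ?(cvg_lim _ ul'). Qed.

Lemma cvg_complex u (x y : R) :
  (fun n => complex.Re (u n)) @ \oo --> x ->
  (fun n => complex.Im (u n)) @ \oo --> y -> u @ \oo --> x +i* y.
Proof.
move=> /cvgrPdist_lt ux /cvgrPdist_lt uy; apply/cvgcP => e e0.
have e20 : 0 < e / 2 by rewrite divr_gt0.
have [N1 _ u1] := ux _ e20; have [N2 _ u2] := uy _ e20.
exists (maxn N1 N2) => n; rewrite geq_max => /andP[/u1 /= n1 /u2 /= n2].
have -> : x +i* y - u n = (x - complex.Re (u n)) +i* (y - complex.Im (u n)).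
  by case: (u n).
by rewrite (le_lt_trans (normc_le_Re_Im _ _))// (splitr e) ltrD.
Qed.

Lemma bounded_series_cvg (a b : nat -> R) (M : R) : (forall n, `|a n| <= b n) ->
  (forall n, \sum_(0 <= k < n) b k <= M) -> cvgn (series a).
Proof.
move=> ab bM; apply: normed_cvg.
apply: (@series_le_cvg _ _ b) => //.
- by move=> n /=.
- by move=> n; exact: le_trans (normr_ge0 _) (ab n).
apply: nondecreasing_is_cvgn.
  apply: nondecreasing_series => n *.
  exact: le_trans (normr_ge0 _) (ab _).
by exists M => _ [n _ <-]; exact: bM.
Qed.

Lemma abs_cvg_series u (M : R) :
  (forall n, \sum_(0 <= k < n) normc (u k) <= M) ->
  exists l, series u @ \oo --> l.
Proof.
move=> uM.
have re := bounded_series_cvg (fun n => normc_Re (u n)) uM.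
have im := bounded_series_cvg (fun n => normc_Im (u n)) uM.
eexists; apply: cvg_complex.
  by under eq_fun do rewrite /series/= raddf_sum; exact: re.
by under eq_fun do rewrite /series/= raddf_sum; exact: im.
Qed.

Lemma cvg_series_finite u N : (forall n, (N <= n)%N -> u n = 0) ->
  series u @ \oo --> \sum_(0 <= k < N) u k.
Proof.
move=> u0; apply/cvgcP => e e0; exists N => n Nn.
rewrite /series /= (big_cat_nat (leq0n N) Nn)//= [X in _ - (_ + X)]big_nat_cond.
by rewrite [X in _ - (_ + X)]big1 ?addr0 ?subrr ?normc0//
  => i /andP[/andP[/u0]].
Qed.

Lemma cvg_seriesZ u l c : series u @ \oo --> l ->
  series (fun n => c * u n) @ \oo --> c * l.
Proof.
move=> ul; rewrite (_ : series _ = (fun n => c * series u n)).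
  exact: (cvgM (cvg_cst _) ul).
by apply/funext => n; rewrite /series/= mulr_sumr.
Qed.

Lemma cvg_seriesD u v l l' : series u @ \oo --> l -> series v @ \oo --> l' ->
  series (fun n => u n + v n) @ \oo --> l + l'.
Proof.
move=> ul vl; rewrite (_ : series _ = (fun n => series u n + series v n)).
  exact: (cvgD ul vl).
by apply/funext => n; rewrite /series/= big_split.
Qed.

Lemma cvg_series_sum (I : Type) (r : seq I) (F : I -> nat -> C) (L : I -> C) :
  (forall i, series (F i) @ \oo --> L i) ->
  series (fun n => \sum_(i <- r) F i n) @ \oo --> \sum_(i <- r) L i.
Proof.
move=> FL; elim: r => [|i r IHr].
  rewrite big_nil; have := @cvg_series_finite (fun=> 0) 0 (fun _ _ => erefl).
  rewrite big_geq//.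
  by under [X in _ -> series X @ _ --> _]eq_fun do rewrite big_nil.
rewrite big_cons.
under [X in series X @ _ --> _]eq_fun do rewrite big_cons.
exact: (cvg_seriesD (FL i) IHr).
Qed.

(** The larger rectangle is the smaller one, the strip to its right and the
    strip below both. *)
Lemma sum_rectangleB (V : zmodType) (a : nat -> nat -> V) N0 K0 N K :
  (N0 <= N)%N -> (K0 <= K)%N ->
  \sum_(0 <= n < N) \sum_(0 <= k < K) a n k
    - \sum_(0 <= n < N0) \sum_(0 <= k < K0) a n k =
  \sum_(0 <= n < N0) \sum_(K0 <= k < K) a n k
    + \sum_(N0 <= n < N) \sum_(0 <= k < K) a n k.
Proof.
move=> hN hK; rewrite (big_cat_nat (leq0n N0) hN)//= addrAC; congr (_ + _).
rewrite -sumrB; apply: eq_bigr => n _.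
by rewrite (big_cat_nat (leq0n K0) hK)/= addrAC subrr add0r.
Qed.

(** Some finite rectangle carries all but [e / 2] of the supremum of the sums of
    moduli. The sum over any larger rectangle is within [e / 2] of the sum over
    this one, and so are the two iterated sums, as limits of such sums. *)
Lemma fubini_series (a : nat -> nat -> C) (M : R) :
  (forall N K, \sum_(0 <= n < N) \sum_(0 <= k < K) normc (a n k) <= M) ->
  exists (r c : nat -> C) (s : C), [/\ forall n, series (a n) @ \oo --> r n,
    forall k, series (a^~ k) @ \oo --> c k,
    series r @ \oo --> s & series c @ \oo --> s].
Proof.
(* Stated for [b] so that it applies to the family and to its transpose; the
   last clause says that the iterated sum is a limit over rectangles. *)
have main (b : nat -> nat -> C) :
  (forall N K, \sum_(0 <= n < N) \sum_(0 <= k < K) normc (b n k) <= M) ->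
  exists (r : nat -> C) (s : C),
    [/\ forall n, series (b n) @ \oo --> r n, series r @ \oo --> s &
    forall (e : R) N0 K0 (A : C), (forall N K, (N0 <= N)%N -> (K0 <= K)%N ->
      normc (A - \sum_(0 <= n < N) \sum_(0 <= k < K) b n k) <= e) ->
    normc (A - s) <= e].
  move=> bM.
  have row n K : \sum_(0 <= k < K) normc (b n k) <= M.
    apply: le_trans (bM n.+1 K); rewrite big_nat_recr//= lerDr.
    by apply: sumr_ge0 => i _; apply: sumr_ge0 => j _; exact: normc_ge0.
  have /choice[r br] n : exists l : C, series (b n) @ \oo --> l.
    exact: abs_cvg_series (row n).
  have rowN N : (fun K => \sum_(0 <= n < N) series (b n) K) @ \oo -->
      \sum_(0 <= n < N) r n.
    rewrite (_ : (fun K => _) = series (fun k => \sum_(0 <= n < N) b n k)).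
      exact: cvg_series_sum.
    by apply/funext => K; rewrite /series/= exchange_big.
  have [s rs] : exists s : C, series r @ \oo --> s.
    apply: (@abs_cvg_series _ M) => N.
    have cv : (fun K => \sum_(0 <= n < N) normc (series (b n) K)) @ \oo -->
        \sum_(0 <= n < N) normc (r n).
      elim: N => [|N IHN].
        by under eq_fun do rewrite big_geq//; rewrite big_geq//; exact: cvg_cst.
      under eq_fun do rewrite big_nat_recr//=.
      by rewrite big_nat_recr//=; apply: cvgD => //; exact: cvg_normc.
    apply: (cvgr_to_le cv); apply: nearW => K.
    apply: le_trans (bM N K); apply: ler_sum => n _; exact: normc_sum.
  exists r, s; split; [exact: br|exact: rs|move=> e N0 K0 A Ab].
  apply: (@normc_lim_le (fun N => A - series r N) _ _ N0).
    exact: (cvgB (cvg_cst _) rs).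
  move=> N hN; apply: (@normc_lim_le
    (fun K => A - \sum_(0 <= n < N) series (b n) K) _ _ K0).
    exact: (cvgB (cvg_cst _) (rowN N)).
  by move=> K; exact: Ab.
move=> aM.
have [r [s [ar rs sP]]] := main _ aM.
have [|c [s' [ac cs s'P]]] := main (fun k n => a n k).
  by move=> K N; rewrite exchange_big.
exists r, c, s; split; [exact: ar|exact: ac|exact: rs|].
suff -> : s = s' by exact: cs.
pose A N K := \sum_(0 <= n < N) \sum_(0 <= k < K) a n k.
pose T N K := \sum_(0 <= n < N) \sum_(0 <= k < K) normc (a n k).
pose E := [set T NK.1 NK.2 | NK in [set: nat * nat]].
have supE : has_sup E.
  split; first by exists (T 0%N 0%N), (0%N, 0%N).
  by exists M => _ [NK _ <-]; exact: aM.
apply/eqP; rewrite -subr_eq0; apply/eqP/normc_le0_eq0.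
apply/ler_addgt0Pr => e e0; rewrite add0r.
have e20 : 0 < e / 2 by rewrite divr_gt0.
have [_ [[N0 K0] _ /= <-] supT] := sup_adherent e20 supE.
have close N K : (N0 <= N)%N -> (K0 <= K)%N ->
    normc (A N0 K0 - A N K) <= e / 2.
  move=> hN hK; rewrite normcB /A sum_rectangleB//.
  have TE : T N K - T N0 K0 <= e / 2.
    have : T N K <= sup E by apply: sup_upper_bound => //; exists (N, K).
    move: supT; lra.
  apply: le_trans TE; rewrite /T sum_rectangleB//.
  rewrite (le_trans (ler_normcD _ _))// lerD//.
    rewrite (le_trans (normc_sum _ _ _))// ler_sum// => n _.
    exact: normc_sum.
  rewrite (le_trans (normc_sum _ _ _))// ler_sum// => n _.
  exact: normc_sum.
have -> : s - s' = (A N0 K0 - s') - (A N0 K0 - s).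
  ring.
rewrite (le_trans (ler_normcD _ _))// (splitr e) lerD//.
  apply: (s'P _ K0 N0) => K N hK hN; rewrite exchange_big; exact: close.
by rewrite normcN; apply: (sP _ N0 K0) => N K; exact: close.
Qed.

End ComplexSeries.

(** * Products and powers of series *)

Section CauchyProduct.
Variable R : realType.
Local Notation C := R[i].
Implicit Types (x y : nat -> C).

Definition cauchy_prod (V : pzSemiRingType) (x y : nat -> V) (k : nat) : V :=
  \sum_(0 <= n < k.+1) x n * y (k - n)%N.

Lemma normc_cauchy_prod x y k : normc (cauchy_prod x y k) <=
  cauchy_prod (normc \o x) (normc \o y) k.
Proof.
rewrite (le_trans (normc_sum _ _ _))// ler_sum// => n _.
by rewrite normcM.
Qed.

Lemma sum_delayed (V : nmodType) (f : nat -> V) n K :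
  \sum_(0 <= k < K) (if (n <= k)%N then f (k - n)%N else 0) =
  \sum_(0 <= k < K - n) f k.
Proof.
have [Kn|nK] := leqP K n.
  rewrite (eqP Kn) [RHS]big_geq// big_nat big1// => k /andP[_ kK].
  by rewrite leqNgt (leq_trans kK Kn).
rewrite (big_cat_nat (leq0n n) (ltnW nK)) /= big_nat big1 ?add0r; last first.
  by move=> k /andP[_ kn]; rewrite leqNgt kn.
rewrite -{1}[n]add0n big_addn; apply: eq_bigr => k _.
by rewrite leq_addl addnK.
Qed.

Lemma ler_sum_extend (f : nat -> R) n m : (forall k, 0 <= f k) -> (n <= m)%N ->
  \sum_(0 <= k < n) f k <= \sum_(0 <= k < m) f k.
Proof.
move=> f0 nm; rewrite (big_cat_nat (leq0n n) nm)/= lerDl.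
by apply: sumr_ge0.
Qed.

Lemma sum_cauchy_prod_le (f g : nat -> R) (A B : R) :
  (forall k, 0 <= f k) -> (forall k, 0 <= g k) -> 0 <= B ->
  (forall n, \sum_(0 <= k < n) f k <= A) ->
  (forall n, \sum_(0 <= k < n) g k <= B) ->
  forall n, \sum_(0 <= k < n) cauchy_prod f g k <= A * B.
Proof.
move=> f0 g0 B0 fA gB K.
have -> : \sum_(0 <= k < K) cauchy_prod f g k =
    \sum_(0 <= n < K) f n * \sum_(0 <= k < K - n) g k.
  under [RHS]eq_bigr => n _ do rewrite -sum_delayed mulr_sumr.
  rewrite exchange_big/=; apply: eq_big_nat => k /andP[_ kK].
  rewrite (big_cat_nat (leq0n k.+1) kK)/= [X in _ + X]big_nat.
  rewrite [X in _ + X]big1 ?addr0; last first.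
    by move=> n /andP[kn _]; rewrite leqNgt kn mulr0.
  by apply: eq_big_nat => n /andP[_ nk]; rewrite -ltnS nk.
apply: le_trans (_ : \sum_(0 <= n < K) f n * B <= _).
  by apply: ler_sum => n _; rewrite ler_wpM2l.
by rewrite -mulr_suml ler_wpM2r.
Qed.

(** Both sides are iterated sums of the family [x n * y (k - n)], [n <= k]. *)
Lemma cvg_cauchy_prod x y (sx sy : C) (A B : R) :
  (forall n, \sum_(0 <= k < n) normc (x k) <= A) ->
  (forall n, \sum_(0 <= k < n) normc (y k) <= B) ->
  series x @ \oo --> sx -> series y @ \oo --> sy ->
  series (cauchy_prod x y) @ \oo --> sx * sy.
Proof.
move=> xA yB xs ys.
pose a n k := if (n <= k)%N then x n * y (k - n)%N else 0.
have A0 : 0 <= A by have := xA 0%N; rewrite big_geq.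
have B0 : 0 <= B by have := yB 0%N; rewrite big_geq.
have aAB N K :
    \sum_(0 <= n < N) \sum_(0 <= k < K) normc (a n k) <= A * B.
  apply: le_trans (_ : \sum_(0 <= n < N) normc (x n) * B <= _).
    apply: ler_sum => n _.
    rewrite (_ : \sum_(0 <= k < K) _ =
      normc (x n) * \sum_(0 <= k < K - n) normc (y k)).
      by rewrite ler_wpM2l// normc_ge0.
    rewrite -sum_delayed mulr_sumr; apply: eq_bigr => k _.
    rewrite /a; case: ifP => _; first by rewrite normcM.
    by rewrite normc0 mulr0.
  by rewrite -mulr_suml ler_wpM2r.
have [r [c [s [ar ac rs cs]]]] := fubini_series aAB.
have rE n : r n = sy * x n.
  apply: (cvg_uniq (ar n)).
  rewrite (_ : series (a n) = fun K => x n * series y (K - n)%N).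
    rewrite mulrC; apply: (cvgM (cvg_cst _)).
    by move: (ys); rewrite -(cvg_centern n (series y) (nbhs sy)); apply.
  apply/funext => K; rewrite /series/= -sum_delayed mulr_sumr.
  by apply: eq_bigr => k _; rewrite /a; case: ifP; rewrite ?mulr0.
have cE k : c k = cauchy_prod x y k.
  apply: (cvg_uniq (ac k)).
  rewrite (_ : cauchy_prod x y k = \sum_(0 <= n < k.+1) a n k).
    by apply: cvg_series_finite => n kn; rewrite /a leqNgt kn.
  by apply: eq_big_nat => n /andP[_ nk]; rewrite /a -ltnS nk.
move: cs; rewrite (_ : c = cauchy_prod x y); last exact/funext.
suff -> : s = sx * sy by [].
apply: (cvg_uniq rs); rewrite (_ : r = fun n => sy * x n); last exact/funext.
by rewrite mulrC; exact: cvg_seriesZ.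
Qed.

Fixpoint cauchy_pow (V : pzSemiRingType) (a : nat -> V) (m : nat) : nat -> V :=
  if m is m'.+1 then cauchy_prod a (cauchy_pow a m')
  else fun n => (n == 0)%:R.

Lemma cauchy_prod_scale (V : comPzSemiRingType) (a b : nat -> V) z n :
  cauchy_prod a b n * z ^+ n =
  cauchy_prod (fun k => a k * z ^+ k) (fun k => b k * z ^+ k) n.
Proof.
rewrite /cauchy_prod mulr_suml; apply: eq_big_nat => k /andP[_ kn].
by rewrite mulrACA -exprD subnKC.
Qed.

Lemma cauchy_pow_scale (V : comPzSemiRingType) (a : nat -> V) z m n :
  cauchy_pow a m n * z ^+ n = cauchy_pow (fun k => a k * z ^+ k) m n.
Proof.
elim: m n => [|m IHm] n /=.
  by case: n => [|n]; rewrite ?mulr1// mul0r.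
rewrite cauchy_prod_scale; apply: eq_bigr => k _.
by rewrite IHm.
Qed.

(** A power series without constant term has an [m]-th power divisible by the
    [m]-th power of the variable. *)
Lemma cauchy_pow_small (V : pzSemiRingType) (a : nat -> V) m n :
  a 0%N = 0 -> (n < m)%N -> cauchy_pow a m n = 0.
Proof.
move=> a0; elim: m n => // m IHm n nm /=.
rewrite /cauchy_prod big_nat_recl//= a0 mul0r add0r.
rewrite big_nat big1// => k /andP[_ kn]; rewrite IHm ?mulr0//.
by rewrite -ltnS (leq_trans _ nm)// ltnS; lia.
Qed.

Lemma sum_cauchy_pow_le (a : nat -> C) (A : R) m :
  (forall n, \sum_(0 <= k < n) normc (a k) <= A) ->
  forall n, \sum_(0 <= k < n) normc (cauchy_pow a m k) <= A ^+ m.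
Proof.
move=> aA; have A0 : 0 <= A by have := aA 0%N; rewrite big_geq.
elim: m => [|m IHm] n /=.
  case: n => [|n]; first by rewrite big_geq ?expr0.
  rewrite big_nat_recl// expr0 (normc_nat R 1) big1 ?addr0// => k _.
  exact: (normc_nat R 0).
apply: (le_trans (ler_sum _ (fun k _ => normc_cauchy_prod _ _ k))).
rewrite exprS; apply: sum_cauchy_prod_le => // [k|k|].
- exact: normc_ge0.
- exact: normc_ge0.
- exact: exprn_ge0.
Qed.

Lemma cvg_cauchy_pow (a : nat -> C) (A : R) (s : C) m :
  (forall n, \sum_(0 <= k < n) normc (a k) <= A) -> series a @ \oo --> s ->
  series (cauchy_pow a m) @ \oo --> s ^+ m.
Proof.
move=> aA as_; elim: m => [|m IHm] /=.
  have := @cvg_series_finite _ (fun n => (n == 0)%:R : C) 1.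
  by rewrite big_nat1/=; apply; case.
rewrite exprS; apply: (cvg_cauchy_prod aA _ as_ IHm).
exact: sum_cauchy_pow_le aA.
Qed.

End CauchyProduct.

(** * The complex exponential *)

Section Exponential.
Variable R : realType.
Local Notation C := R[i].
Local Open Scope complex_scope.

Lemma expR_partial_sum_le (x : R) n : 0 <= x ->
  \sum_(0 <= k < n) x ^+ k / k`!%:R <= expR x.
Proof.
move=> x0; apply: (@nondecreasing_cvgn_le _ (series (exp_coeff x))).
  by apply: nondecreasing_series => k _ _; exact: exp_coeff_ge0.
exact: is_cvg_series_exp_coeff.
Qed.

Lemma normc_divfact (z : C) k : normc (z / k`!%:R) = normc z / k`!%:R.
Proof.
by rewrite normcM normcV normc_nat.
Qed.

Lemma normc_exp_terms_le (z : C) n :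
  \sum_(0 <= k < n) normc (z ^+ k / k`!%:R) <= expR (normc z).
Proof.
apply: le_trans (expR_partial_sum_le n (normc_ge0 z)).
by apply: ler_sum => k _; rewrite normc_divfact normcX.
Qed.

Lemma cvg_cexp (z : C) : series (fun n => z ^+ n / n`!%:R) @ \oo --> cexp z.
Proof.
have [l zl] := abs_cvg_series (normc_exp_terms_le z).
by rewrite /cexp (cvg_lim _ zl).
Qed.
Arguments cvg_cexp z : clear implicits.

Lemma cexpD (z w : C) : cexp (z + w) = cexp z * cexp w.
Proof.
apply: (cvg_uniq (cvg_cexp (z + w))).
rewrite (_ : (fun n => _) = cauchy_prod (fun n => z ^+ n / n`!%:R)
  (fun n => w ^+ n / n`!%:R)).
  exact: (cvg_cauchy_prod (normc_exp_terms_le z) (normc_exp_terms_le w)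
    (cvg_cexp z) (cvg_cexp w)).
apply/funext => n; rewrite addrC exprDn mulr_suml /cauchy_prod big_mkord.
apply: eq_bigr => k _.
have kn : (k <= n)%N by rewrite -ltnS.
have nz m : (m`!%:R : C) != 0 by rewrite pnatr_eq0 -lt0n fact_gt0.
rewrite -(bin_fact kn) !natrM -[_ *+ _]mulr_natr.
have b0 : ('C(n, k)%:R : C) != 0 by rewrite pnatr_eq0 -lt0n bin_gt0.
by field; rewrite b0 !nz.
Qed.

Lemma cexp_real (x : R) : cexp (x%:C) = (expR x)%:C.
Proof.
apply: (cvg_uniq (cvg_cexp _)).
have -> : series (fun n => x%:C ^+ n / n`!%:R) =
    (fun n => (series (exp_coeff x) n)%:C).
  apply/funext => n; rewrite /series/= rmorph_sum; apply: eq_bigr => k _.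
  by rewrite /exp_coeff/= rmorphM rmorphXn fmorphV rmorph_nat.
by apply: cvg_complex => /=; [exact: is_cvg_series_exp_coeff|exact: cvg_cst].
Qed.

Lemma cexp_conjc (z : C) : cexp z^* = (cexp z)^*.
Proof.
apply: (cvg_uniq (cvg_cexp _)).
apply/cvgcP => e e0; have /cvgcP/(_ _ e0)[N zN] := cvg_cexp z.
exists N => n /zN; congr (_ < _).
have <- : ((cexp z) - series (fun n => z ^+ n / n`!%:R) n)^* =
    (cexp z)^* - series (fun n => (z^*) ^+ n / n`!%:R) n.
  rewrite rmorphB; congr (_ - _); rewrite /series/= rmorph_sum.
  by apply: eq_bigr => k _; rewrite rmorphM rmorphXn fmorphV rmorph_nat.
by apply: complexI; rewrite -!norm_normc normcJ.
Qed.

(** The square of the modulus is [cexp z * cexp z^*], the exponential of the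
    real number [2 * Re z]. *)
Lemma normc_cexp (z : C) : normc (cexp z) = expR (complex.Re z).
Proof.
have : (normc (cexp z) ^+ 2)%:C = ((expR (complex.Re z)) ^+ 2)%:C.
  rewrite rmorphXn /= -norm_normc sqr_normc -cexp_conjc -cexpD.
  rewrite addcJ -(rmorph_nat (real_complex R)) -rmorphM cexp_real.
  by congr _%:C; rewrite mulrC expRM_natr.
move=> /complexI/eqP; rewrite eqrXn2// ?normc_ge0 ?expR_ge0//.
by move=> /eqP.
Qed.

Lemma cexp_neq0 (z : C) : cexp z != 0.
Proof.
apply/eqP => z0; have := normc_cexp z.
by rewrite z0 normc0 => /esym/eqP; rewrite gt_eqF// expR_gt0.
Qed.

(** Coefficients of the composition of the exponential with the power series
    [a]; the truncation of the sum is exact when [a 0] vanishes. *)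
Definition exp_compose (a : nat -> C) (n : nat) : C :=
  \sum_(0 <= m < n.+1) cauchy_pow a m n / m`!%:R.

Lemma exp_compose_scale (a : nat -> C) z n :
  exp_compose a n * z ^+ n = exp_compose (fun k => a k * z ^+ k) n.
Proof.
rewrite /exp_compose mulr_suml; apply: eq_bigr => m _.
by rewrite mulrAC cauchy_pow_scale.
Qed.

Lemma normc_cauchy_pow_divfact (b : nat -> C) (A : R) :
  (forall n, \sum_(0 <= k < n) normc (b k) <= A) -> forall M N,
  \sum_(0 <= m < M) \sum_(0 <= n < N) normc (cauchy_pow b m n / m`!%:R) <=
  expR A.
Proof.
move=> bA M N; have A0 : 0 <= A by have := bA 0%N; rewrite big_geq.
apply: le_trans (expR_partial_sum_le M A0); apply: ler_sum => m _.
under eq_bigr do rewrite normc_divfact.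
rewrite -mulr_suml ler_wpM2r ?invr_ge0 ?ler0n//.
exact: sum_cauchy_pow_le.
Qed.

(** The double family [cauchy_pow b m n / m`!] sums by rows to the terms of the
    exponential series at [s] and by columns to [exp_compose b]. *)
Lemma cvg_exp_compose (b : nat -> C) (A : R) (s : C) : b 0%N = 0 ->
  (forall n, \sum_(0 <= k < n) normc (b k) <= A) -> series b @ \oo --> s ->
  series (exp_compose b) @ \oo --> cexp s.
Proof.
move=> b0 bA bs.
have [r [c [t [br bc rt ct]]]] :=
  fubini_series (normc_cauchy_pow_divfact bA).
have rE m : r m = s ^+ m / m`!%:R.
  apply: (cvg_uniq (br m)).
  under [X in series X @ _ --> _]eq_fun do rewrite mulrC.
  by rewrite mulrC; apply: cvg_seriesZ; exact: (cvg_cauchy_pow bA bs).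
have cE n : c n = exp_compose b n.
  apply: (cvg_uniq (bc n)); apply: cvg_series_finite => m nm.
  by rewrite cauchy_pow_small ?mul0r.
have -> : exp_compose b = c by apply/funext => n; rewrite cE.
suff -> : cexp s = t by exact: ct.
apply: (cvg_uniq (cvg_cexp s)).
by rewrite (_ : (fun n => _) = r)//; apply/funext => n; rewrite rE.
Qed.

Lemma sum_exp_compose_le (b : nat -> C) (A : R) : b 0%N = 0 ->
  (forall n, \sum_(0 <= k < n) normc (b k) <= A) ->
  forall n, \sum_(0 <= k < n) normc (exp_compose b k) <= expR A.
Proof.
move=> b0 bA n; apply: le_trans (normc_cauchy_pow_divfact bA n n).
rewrite exchange_big/= big_nat [leRHS]big_nat.
apply: ler_sum => k /andP[_ kn].
apply: (le_trans (normc_sum _ _ _)).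
by apply: ler_sum_extend => // m; exact: normc_ge0.
Qed.

End Exponential.
Arguments cvg_cexp {R} z.

(** * Expansion of a power series at another point *)

Section PowerSeries.
Variable R : realType.
Local Notation C := R[i].

(** Expanding [(a + h) ^+ n] by the binomial formula turns the series into an
    absolutely summable double family, which is then summed by powers of [h]. *)
Lemma analytic_at_recenter (f : C -> C) (c : nat -> C) (rho : R) (a : C) :
  (forall z, normc z < rho -> series (fun n => c n * z ^+ n) @ \oo --> f z) ->
  (forall r : R, 0 <= r < rho ->
    exists M : R, forall n, \sum_(0 <= k < n) normc (c k) * r ^+ k <= M) ->
  normc a < rho -> analytic_at f a.
Proof.
move=> cf cM arho.
pose F (h : C) n k : C := c n * (a ^+ (n - k) * h ^+ k *+ 'C(n, k)).
have FB h : normc a + normc h < rho -> exists M : R, forall N K,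
    \sum_(0 <= n < N) \sum_(0 <= k < K) normc (F h n k) <= M.
  move=> ah; have [|M cMah] := cM (normc a + normc h).
    by rewrite ah addr_ge0 ?normc_ge0.
  exists M => N K; apply: le_trans (cMah N); apply: ler_sum => n _.
  under eq_bigr do rewrite normcM.
  rewrite -mulr_sumr ler_wpM2l ?normc_ge0// exprDn -(big_mkord xpredT
    (fun i => normc a ^+ (n - i) * normc h ^+ i *+ 'C(n, i))).
  have E k : normc (a ^+ (n - k) * h ^+ k *+ 'C(n, k)) =
      normc a ^+ (n - k) * normc h ^+ k *+ 'C(n, k).
    by rewrite -mulr_natr !normcM normc_nat !normcX mulr_natr.
  rewrite (eq_bigr _ (fun k _ => E k)).
  have [nK|Kn] := leqP n.+1 K.
    rewrite (big_cat_nat (leq0n n.+1) nK)/= gerDl.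
    by rewrite big_nat big1// => k /andP[nk _]; rewrite bin_small ?mulr0n.
  apply: ler_sum_extend (ltnW Kn) => k.
  by rewrite mulrn_wge0// mulr_ge0// exprn_ge0// normc_ge0.
have rowF h n : series (F h n) @ \oo --> c n * (a + h) ^+ n.
  have := @cvg_series_finite _ (F h n) n.+1.
  rewrite /F -mulr_sumr exprDn big_mkord; apply => k nk.
  by rewrite bin_small// mulr0n mulr0.
have colF h k : F h ^~ k = fun n => h ^+ k * (c n * (a ^+ (n - k) *+ 'C(n, k))).
  by apply/funext => n; rewrite /F -!mulrnAr !mulrA; ring.
(* The coefficients at [a] are the column sums for a fixed increment [h0],
   divided by [h0 ^+ k]; any admissible nonzero increment gives the same. *)
pose h0 : C := (real_complex R ((rho - normc a) / 2)).
have d0 : 0 < (rho - normc a) / 2 by rewrite divr_gt0// subr_gt0.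
have nh0 : normc h0 = (rho - normc a) / 2.
  by rewrite normc_real ger0_norm ?ltW.
have h00 : h0 != 0 by rewrite -normc_gt0 nh0.
have ah0 : normc a + normc h0 < rho by rewrite nh0; move: d0; lra.
have [M0 /fubini_series[_ [col [_ [_ colcvg _ _]]]]] := FB _ ah0.
exists (fun k => col k / h0 ^+ k); apply/nearcP.
exists ((rho - normc a) / 2) => // z za.
have ahz : normc a + normc (z - a) < rho by move: za; lra.
have [M /fubini_series[r [c' [s [rcvg c'cvg rs c's]]]]] := FB _ ahz.
have c'E k : c' k = col k / h0 ^+ k * (z - a) ^+ k.
  apply: (cvg_uniq (c'cvg k)).
  have -> : F (z - a) ^~ k =
      fun n => (z - a) ^+ k / h0 ^+ k * F h0 n k.
    apply/funext => n; rewrite (congr1 (@^~ n) (colF (z - a) k)).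
    rewrite (congr1 (@^~ n) (colF h0 k))/= [RHS]mulrA divfK//.
    by rewrite expf_neq0.
  rewrite (_ : col k / _ * _ = (z - a) ^+ k / h0 ^+ k * col k); last by ring.
  by apply: cvg_seriesZ; exact: colcvg.
have -> : (fun n => col n / h0 ^+ n * (z - a) ^+ n) = c'.
  by apply/funext => k; rewrite c'E.
suff -> : f z = s by exact: c's.
have zrho : normc z < rho.
  by apply: le_lt_trans ahz; rewrite -{1}(subrKC a z) ler_normcD.
apply: (cvg_uniq (cf _ zrho)).
rewrite (_ : (fun n => c n * z ^+ n) = r) //.
apply/funext => n; apply/esym/(cvg_uniq (rcvg n)).
by have := rowF (z - a) n; rewrite subrKC.
Qed.

End PowerSeries.

(** * The powers of 3 dividing [2 ^ n - 1] *)

Section Valuation.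
Local Open Scope nat_scope.

Lemma expnS_second_order (y q : nat) :
  exists k, y.+1 ^ q = 1 + q * y + y ^ 2 * k.
Proof.
elim: q => [|q [k IHq]]; first by exists 0; rewrite expn0 muln0.
by exists (q + k * y.+1); rewrite expnS IHq; ring.
Qed.

(** The induction step cubes [1 + y] with [y = 3 ^ i.+1 * m]: the cube is
    [1 + 3 y (1 + y + y ^ 2 / 3)] and the last factor is prime to 3. *)
Lemma exp2_double_pow3 i :
  exists2 m, 2 ^ (2 * 3 ^ i) = 1 + 3 ^ i.+1 * m & ~~ (3 %| m).
Proof.
elim: i => [|i [m IHi m3]]; first by exists 1.
have -> : 2 * 3 ^ i.+1 = (2 * 3 ^ i) * 3 by rewrite expnS; ring.
exists (m * (1 + 3 * (3 ^ i * m + 3 ^ i * 3 ^ i * m ^ 2))).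
  by rewrite expnM IHi !expnS; ring.
by rewrite Euclid_dvdM// negb_or m3/= addnC dvdn_addr// dvdn_mulr.
Qed.

(** If [2 ^ (2 * 3 ^ i) = 1 + 3 ^ i.+1 * m] with [m] prime to 3, its [q]-th
    power is [1 + 3 ^ i.+1 * q * m] modulo [3 ^ i.+2], hence 1 modulo
    [3 ^ i.+2] exactly when 3 divides [q]. *)
Lemma dvdn_exp2B1 i n : 0 < n ->
  (3 ^ i.+1 %| 2 ^ n - 1) = (2 * 3 ^ i %| n).
Proof.
move=> n0; apply/idP/idP; last first.
  move=> /dvdnP[q ->]; have [m Em _] := exp2_double_pow3 i.
  rewrite mulnC expnM Em add1n.
  have [k ->] := expnS_second_order (3 ^ i.+1 * m) q.
  rewrite -addnA addnC addnK dvdn_add//.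
    by rewrite mulnCA dvdn_mulr.
  by rewrite -mulnA -mulnA dvdn_mulr.
elim: i => [|i IHi] h.
  rewrite muln1 dvdn2; apply/negP => on; move: h.
  rewrite expn1 -(odd_double_half n) on expnD -mul2n expnM.
  have [k] := expnS_second_order 3 n./2; rewrite -[3.+1]/(2 ^ 2) => ->.
  rewrite -[2 ^ true]/2 -[3 ^ 2]/9.
  rewrite (_ : _ - 1 = 3 * (2 * (n./2 + 3 * k)) + 1); last by lia.
  by rewrite dvdn_addr; last exact: dvdn_mulr.
have [q nq] : exists q, n = (2 * 3 ^ i) * q.
  have /dvdnP[q ->] : 2 * 3 ^ i %| n.
    by apply: IHi; apply: dvdn_trans h; rewrite [in X in _ %| X]expnS dvdn_mull.
  by exists q; rewrite mulnC.
have [m Em m3] := exp2_double_pow3 i.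
suff q3 : 3 %| q.
  by rewrite nq expnSr mulnA dvdn_pmul2l// muln_gt0 expn_gt0.
move: h; rewrite {1}nq expnM Em add1n.
have [k ->] := expnS_second_order (3 ^ i.+1 * m) q.
have -> : 1 + q * (3 ^ i.+1 * m) + (3 ^ i.+1 * m) ^ 2 * k - 1 =
    3 ^ i.+1 * (q * m + 3 * (3 ^ i * m ^ 2 * k)).
  by rewrite -addnA addnC addnK !expnS; ring.
rewrite expnSr dvdn_pmul2l ?expn_gt0// dvdn_addl; last exact: dvdn_mulr.
by rewrite Euclid_dvdM// (negbTE m3) orbF.
Qed.

End Valuation.

(** * Counting the fixed characters *)

Section CountingCharacters.
Variable R : realType.
Local Notation C := R[i].
Local Notation X := (dual R Zthird).

Lemma dual_eq (G : zmodType) (chi chi' : dual R G) : chi =1 chi' -> chi = chi'.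
Proof.
case: chi chi' => [f fD fn] [g gD gn] /= /funext fg; subst g.
by congr Character; exact: Prop_irrelevance.
Qed.

Lemma char_neq0 (G : zmodType) (chi : dual R G) x : chi x != 0.
Proof. by rewrite -normr_eq0 char_norm oner_eq0. Qed.

Lemma char0 (G : zmodType) (chi : dual R G) : chi 0 = 1.
Proof.
apply: (mulfI (char_neq0 chi 0)); by rewrite -charD addr0 mulr1.
Qed.

Lemma charMn (G : zmodType) (chi : dual R G) x n : chi (x *+ n) = chi x ^+ n.
Proof.
elim: n => [|n IHn]; first by rewrite mulr0n char0.
by rewrite mulrS charD IHn exprS.
Qed.

Lemma charMz (G : zmodType) (chi : dual R G) x (z : int) :
  chi (x *~ z) = chi x ^ z.
Proof.
case: z => n; first by rewrite -pmulrn charMn.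
apply: (mulIf (char_neq0 chi (x *+ n.+1))).
rewrite NegzE mulrNz -pmulrn -charD addNr char0 charMn.
by rewrite -exprnN mulVf// expf_neq0// char_neq0.
Qed.

Lemma iter_dual_mul2 n (chi : X) x :
  iter n (@dual_map R Zthird Zthird mul2) chi x = chi (x *+ 2 ^ n).
Proof.
elim: n x => [|n IHn] x; first by rewrite expn0 mulr1n.
rewrite iterS /= IHn; congr (chi _).
by rewrite /mul2 mulr_natl -mulrnA expnS.
Qed.

Lemma fixed_dual_mul2P n (chi : X) : (0 < n)%N ->
  fixed_points (@dual_map R Zthird Zthird mul2) n chi <->
  forall x : Zthird, chi (x *+ (2 ^ n - 1)) = 1.
Proof.
move=> n0; have E x : chi (x *+ 2 ^ n) = chi x * chi (x *+ (2 ^ n - 1)).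
  by rewrite -charD -mulrS -subSn ?expn_gt0// subn1.
split=> [fx x|fx].
  apply: (mulfI (char_neq0 chi x)); rewrite -E mulr1.
  by rewrite -iter_dual_mul2; congr (char_fun _ x).
by apply: dual_eq => x; rewrite iter_dual_mul2 E fx mulr1.
Qed.

Lemma third_subproof k : ((3%:R : rat) ^+ k)^-1 \in is_Zthird.
Proof. by apply/is_ZthirdP; exists k; rewrite mulVf ?expf_neq0. Qed.

Definition third k : Zthird :=
  exist (fun x => x \in is_Zthird) _ (third_subproof k).

Lemma third_mulrn k : third k *+ 3 ^ k = 1.
Proof.
apply: val_inj; rewrite raddfMn /= -[_ *+ 3 ^ k]mulr_natr natrX.
by rewrite mulVf ?expf_neq0.
Qed.

Variable d : nat.
Hypotheses (d_gt0 : (0 < d)%N) (d_coprime : coprime 3 d).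

Let e := totient d.

Let e_gt0 : (0 < e)%N. Proof. by rewrite totient_gt0. Qed.

Let root_pow3 (w : C) j : w ^+ d = 1 -> w ^+ (3 ^ (e * j)) = w.
Proof.
move=> wd; have : (3 ^ (e * j) = 1 %[mod d])%N.
  by rewrite expnM -modnXm Euler_exp_totient// modnXm exp1n.
by move=> E; rewrite -[LHS](expr_mod _ wd) E expr_mod.
Qed.

Let root_exprz_pow3 (w : C) (t : int) j : w ^+ d = 1 ->
  w ^ (t * (3 ^ (e * j))%N%:Z) = w ^ t.
Proof. by move=> wd; rewrite mulrC -exprz_exp -exprnP root_pow3. Qed.

Let scaled_int (x : Zthird) :
  exists j, exists z : int, x *+ (3 ^ (e * j)) = 1 *~ z.
Proof.
have /is_ZthirdP[k /intrP[m xm]] := valP x.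
exists k; exists (m * (3 ^ (e * k - k))%N%:Z).
apply: val_inj; rewrite raddfMn rmorph_int /= -[_ *+ 3 ^ _]mulr_natr natrX.
have -> : (e * k = k + (e * k - k))%N by rewrite subnKC// leq_pmull.
by rewrite exprD mulrA xm addKn intrM -pmulrn natrX.
Qed.

(** Since [3 ^ e] is 1 modulo [d], the power [w ^ (3 ^ (e * j) x)] does not
    depend on the [j] that clears the denominator of [x]. *)
Let exponent (x : Zthird) : int := projT1 (cid (projT2 (cid (scaled_int x)))).

Let root_char_fun (w : C) (x : Zthird) : C := w ^ exponent x.

Let root_char_funE w x j z : w ^+ d = 1 ->
  x *+ (3 ^ (e * j)) = 1 *~ z -> root_char_fun w x = w ^ z.
Proof.
move=> wd xz; rewrite /root_char_fun /exponent.
case: (cid (scaled_int x)) => k kP /=; case: cid => y /= xy.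
have E : y * (3 ^ (e * j))%N%:Z = z * (3 ^ (e * k))%N%:Z.
  have /(congr1 val) : (1 : Zthird) *~ y *+ 3 ^ (e * j) =
      1 *~ z *+ 3 ^ (e * k).
    by rewrite -xy -xz -!mulrnA mulnC.
  rewrite !rmorphMn !rmorph_int -[LHS]mulr_natr -[RHS]mulr_natr => E.
  by apply/eqP; rewrite -(eqr_int rat) !intrM; apply/eqP; rewrite -!pmulrn.
by rewrite -(root_exprz_pow3 y j wd) E root_exprz_pow3.
Qed.

Let root_neq0 (w : C) : w ^+ d = 1 -> w != 0.
Proof.
by move=> wd; apply/eqP => w0; move: wd; rewrite w0 expr0n gtn_eqF//
  => /esym/eqP; rewrite oner_eq0.
Qed.

Let root_char_funD w : w ^+ d = 1 -> forall x y,
  root_char_fun w (x + y) = root_char_fun w x * root_char_fun w y.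
Proof.
move=> wd x y.
have [j [z xz]] := scaled_int x; have [k [t yt]] := scaled_int y.
rewrite (root_char_funE wd xz) (root_char_funE wd yt).
rewrite (@root_char_funE _ _ (j + k)
  (z * (3 ^ (e * k))%N%:Z + t * (3 ^ (e * j))%N%:Z))//.
  by rewrite expfzDr ?root_neq0// !root_exprz_pow3.
rewrite mulnDr expnD mulrnDl [in RHS]mulrzDr !mulrzA -xz -yt -!pmulrn.
by rewrite -!mulrnA [(3 ^ (e * k) * _)%N]mulnC.
Qed.

Let root_char_fun_norm w : w ^+ d = 1 -> forall x, `|root_char_fun w x| = 1.
Proof.
move=> wd x.
have w1 : `|w| = 1.
  apply/eqP; rewrite -(@pexpr_eq1 _ _ d)// -normrX wd normr1//.
by rewrite /root_char_fun; case: (exponent x) => n;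
  rewrite ?NegzE -?exprnN ?normrV -?exprnP ?normrX ?w1 ?expr1n ?invr1//
    unitfE expf_neq0// root_neq0.
Qed.

Let root_char w (wd : w ^+ d = 1) : X :=
  Character (root_char_funD wd) (root_char_fun_norm wd).

Let root_char_one w (wd : w ^+ d = 1) : root_char wd 1 = w.
Proof. by rewrite /= (@root_char_funE _ _ 0 1 wd)// muln0 mulr1n. Qed.

Lemma unity_roots : exists2 s : seq C, uniq s /\ size s = d &
  forall w, (w \in s) = (w ^+ d == 1).
Proof.
have [s sE] := closed_field_poly_normal ('X^d - 1 : {poly C}).
have l1 : lead_coef ('X^d - 1 : {poly C}) = 1 := monicP (monicXnsubC 1 d_gt0).
rewrite l1 scale1r in sE.
exists s.
  split.
    rewrite -separable_prod_XsubC -sE separable_Xn_sub_1//.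
    by rewrite pnatr_eq0 -lt0n.
  apply/eqP; rewrite -eqSS -(size_prod_XsubC s id) -sE.
  by rewrite size_Xn_sub_1.
by move=> w; rewrite -root_prod_XsubC -sE rootE !hornerE subr_eq0.
Qed.

(** Such a character takes its values in the [d]-th roots of unity, on which
    raising to the power 3 is injective. It is therefore determined by its value
    at 1, which can be any [d]-th root of unity. *)
Lemma card_char_trivial_on_multiples a :
  #|` fset_set [set chi : X | forall x, chi (x *+ (3 ^ a * d)) = 1]| = d.
Proof.
set F := [set chi : X | _].
have [s [us ss] sP] := unity_roots; rewrite -[RHS]ss.
apply: card_fset_set.
have Froot chi : F chi -> forall x, chi x ^+ d = 1.
  move=> Fchi x; rewrite -charMn -[x]mul1r -(third_mulrn a).
  by rewrite mulrnAl -mulrnA Fchi.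
have Fs chi : F chi -> chi 1 \in s.
  by move=> Fchi; rewrite sP Froot.
pose f (chi : X) := index (chi 1) s.
suff <- : f @` F = `I_(size s).
  rewrite card_eq_sym; apply: inj_card_eq => chi chi' /set_mem Fc /set_mem Fc'.
  move=> /(congr1 (nth 0 s)); rewrite !nth_index ?Fs// => c1.
  apply: dual_eq => x; have [j [z xz]] := scaled_int x.
  rewrite -(root_pow3 j (Froot _ Fc x)) -(root_pow3 j (Froot _ Fc' x)).
  by rewrite -!charMn xz !charMz c1.
apply/seteqP; split=> [_ [chi Fchi <-]|i /= si].
  by rewrite /= index_mem Fs.
have wd : nth 0 s i ^+ d = 1 by apply/eqP; rewrite -sP mem_nth.
exists (root_char wd); last by rewrite /f root_char_one index_uniq.
move=> x; rewrite charMn mulnC exprM.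
suff -> : root_char wd x ^+ d = 1 by rewrite expr1n.
by rewrite /= /root_char_fun exprnP exprz_exp mulrC -exprz_exp -exprnP wd
  exp1rz.
Qed.

End CountingCharacters.

Lemma num_fixed_dual_mul2 (R : realType) n : (0 < n)%N ->
  num_fixed_points (@dual_map R Zthird Zthird mul2) n =
  ((2 ^ n - 1) %/ 3 ^ logn 3 (2 ^ n - 1))%N.
Proof.
move=> n0; have N0 : (0 < 2 ^ n - 1)%N.
  by rewrite subn_gt0 -{1}(expn0 2) ltn_exp2l.
have [//|d d3 E] := @pfactor_coprime 3 (2 ^ n - 1) isT.
rewrite /num_fixed_points {1}E mulnK ?expn_gt0//.
have d0 : (0 < d)%N by move: N0; rewrite E muln_gt0 => /andP[].
rewrite -[RHS](card_char_trivial_on_multiples R d0 d3 (logn 3 (2 ^ n - 1))).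
congr (#|` fset_set _|)%fset; apply/seteqP; split=> chi.
  by move=> /(fixed_dual_mul2P _ n0) h x; rewrite mulnC -E.
by move=> h; apply/(fixed_dual_mul2P _ n0) => x; rewrite E mulnC; exact: h.
Qed.

(** * The zeta function inside the disc *)

Section LogZeta.
Variable R : realType.
Local Notation C := R[i].
Local Notation f := (@dual_map R Zthird Zthird mul2).
Local Open Scope complex_scope.

(** The 3-adic absolute value of [2 ^ n - 1]. *)
Definition weight (n : nat) : R := ((3 : R) ^+ logn 3 (2 ^ n - 1))^-1.

Lemma weight_ge0 n : 0 <= weight n.
Proof. by rewrite invr_ge0 exprn_ge0. Qed.

Lemma weight_le1 n : weight n <= 1.
Proof. by rewrite invf_le1 ?exprn_gt0// exprn_ege1// ler1n. Qed.

Lemma num_fixedE n : (0 < n)%N ->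
  (num_fixed_points f n)%:R = (2 ^+ n - 1) * weight n :> R.
Proof.
move=> n0; rewrite num_fixed_dual_mul2// /weight.
have v0 : ((3 ^ logn 3 (2 ^ n - 1))%:R : R) != 0.
  by rewrite pnatr_eq0 -lt0n expn_gt0.
rewrite -[3 ^+ _]natrX; apply: (mulIf v0); rewrite mulfVK// -natrM.
by rewrite divnK ?pfactor_dvdnn// natrB ?expn_gt0// natrX.
Qed.

Definition log_coeff (n : nat) : C := (num_fixed_points f n)%:R / n%:R.

Lemma log_coeff0 : log_coeff 0 = 0.
Proof. by rewrite /log_coeff invr0 mulr0. Qed.

Lemma log_termE z n :
  z ^+ n / n%:R * (num_fixed_points f n)%:R = log_coeff n * z ^+ n.
Proof. by rewrite /log_coeff; ring. Qed.

Lemma normc_log_coeff n : normc (log_coeff n) <= 2 ^+ n.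
Proof.
case: n => [|n].
  by rewrite log_coeff0 normc0 exprn_ge0.
rewrite normcM normcV !normc_nat.
rewrite num_fixedE// ler_pdivrMr ?ltr0n//.
have p0 : 1 <= 2 ^+ n.+1 :> R by rewrite exprn_ege1// ler1n.
apply: le_trans (_ : 2 ^+ n.+1 * 1 <= _).
  apply: ler_pM; rewrite ?subr_ge0 ?weight_ge0 ?weight_le1//.
  by rewrite gerBl.
by rewrite ler_wpM2l ?exprn_ge0// ler1n.
Qed.

Lemma sum_geometric_le (x : R) n : 0 <= x < 1 ->
  \sum_(0 <= k < n) x ^+ k <= (1 - x)^-1.
Proof.
move=> /andP[x0 x1].
have x10 : 0 < 1 - x by rewrite subr_gt0.
rewrite big_mkord -[leRHS]mul1r ler_pdivlMr// mulrC -opprB mulNr -subrX1 opprB.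
by rewrite gerBl exprn_ge0.
Qed.

Lemma sum_log_coeff_le (r : R) n : 0 <= r < 2^-1 ->
  \sum_(0 <= k < n) normc (log_coeff k) * r ^+ k <= (1 - 2 * r)^-1.
Proof.
move=> /andP[r0 r2].
apply: le_trans (@sum_geometric_le (2 * r) n _); last first.
  by rewrite mulr_ge0//=; move: r2; lra.
apply: ler_sum => k _; rewrite exprMn ler_wpM2r ?exprn_ge0//.
exact: normc_log_coeff.
Qed.

Lemma normc_mulX (c z : C) k : normc (c * z ^+ k) = normc c * normc z ^+ k.
Proof. by rewrite normcM normcX. Qed.

Lemma zeta_cvg (z : C) : normc z < 2^-1 ->
  exists2 s, series (fun n => log_coeff n * z ^+ n) @ \oo --> s &
    dynamical_zeta f z = cexp s.
Proof.
move=> z2; have [|s zs] := @abs_cvg_series R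
    (fun n => log_coeff n * z ^+ n) (1 - 2 * normc z)^-1.
  move=> n; under eq_bigr do rewrite normc_mulX.
  by apply: sum_log_coeff_le; rewrite normc_ge0.
exists s; first exact: zs.
rewrite /dynamical_zeta; congr (cexp _).
rewrite [X in limn X](_ : _ = series (fun n => log_coeff n * z ^+ n)).
  exact: (cvg_lim _ zs).
apply/funext => -[|N]; first by rewrite /series/= !big_geq.
rewrite /series/= [RHS]big_ltn// log_coeff0 mul0r add0r.
by apply: eq_bigr => n _; exact: log_termE.
Qed.

Lemma zeta_power_series (z : C) : normc z < 2^-1 ->
  series (fun n => exp_compose log_coeff n * z ^+ n) @ \oo -->
  dynamical_zeta f z.
Proof.
move=> z2; have [s zs ->] := zeta_cvg z2.
under [X in series X @ _ --> _]eq_fun do rewrite exp_compose_scale.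
apply: (@cvg_exp_compose _ _ (1 - 2 * normc z)^-1) => [|n|].
- by rewrite log_coeff0 mul0r.
- under eq_bigr do rewrite normc_mulX.
  by apply: sum_log_coeff_le; rewrite normc_ge0.
- exact: zs.
Qed.

Lemma zeta_analytic (z : C) : normc z < 2^-1 ->
  analytic_at (dynamical_zeta f) z.
Proof.
apply: analytic_at_recenter zeta_power_series _ => r r2.
exists (expR (1 - 2 * r)^-1) => n.
have [r0 r1] := andP r2.
have -> : \sum_(0 <= k < n) normc (exp_compose log_coeff k) * r ^+ k =
    \sum_(0 <= k < n) normc (exp_compose (fun k => log_coeff k * r%:C ^+ k) k).
  by apply: eq_bigr => k _; rewrite -exp_compose_scale normc_mulX normc_real
    ger0_norm.
apply: sum_exp_compose_le => [|m]; first by rewrite log_coeff0 mul0r.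
under eq_bigr do rewrite normc_mulX normc_real ger0_norm//.
exact: sum_log_coeff_le.
Qed.

Lemma zeta_neq0 (z : C) : normc z < 2^-1 -> dynamical_zeta f z != 0.
Proof. by move=> /zeta_cvg[s _ ->]; exact: cexp_neq0. Qed.

End LogZeta.

(** * Radial limits at the roots of unity of 3-power order *)

Section RadialLimits.
Variable R : realType.
Local Notation C := R[i].
Local Notation f := (@dual_map R Zthird Zthird mul2).
Local Open Scope complex_scope.

Definition bounded_sums (b : nat -> C) :=
  exists M : R, forall N, normc (\sum_(0 <= n < N) b n) <= M.

Lemma bounded_sumsD b b' : bounded_sums b -> bounded_sums b' ->
  bounded_sums (fun n => b n + b' n).
Proof.
move=> [M bM] [M' bM']; exists (M + M') => N.
by rewrite big_split (le_trans (ler_normcD _ _))// lerD.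
Qed.

Lemma bounded_sumsZ c b : bounded_sums b -> bounded_sums (fun n => c * b n).
Proof.
move=> [M bM]; exists (normc c * M) => N.
by rewrite -mulr_sumr normcM ler_wpM2l ?normc_ge0.
Qed.

(** Multiplying by [eta ^ d] shifts the sum by [d], which changes it by at most
    [2 d] terms of modulus at most 1. *)
Lemma bounded_sums_root (eta : C) d : (0 < d)%N -> normc eta = 1 ->
  eta ^+ d != 1 -> bounded_sums (fun n => (d %| n.+1)%N%:R * eta ^+ n.+1).
Proof.
move=> d0 eta1 etad; exists ((d + d)%:R / normc (1 - eta ^+ d)) => N.
pose b n : C := (d %| n.+1)%N%:R * eta ^+ n.+1.
rewrite -/(\sum_(0 <= n < N) b n).
have n0 : 0 < normc (1 - eta ^+ d).
  by rewrite normc_gt0 subr_eq0 eq_sym.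
rewrite ler_pdivlMr// -normcM mulrBr mulr1.
have bd n : b n * eta ^+ d = b (n + d)%N.
  by rewrite /b -addSn dvdn_addl// mulrAC -mulrA -exprD addnC.
have -> : (\sum_(0 <= n < N) b n) * eta ^+ d =
    \sum_(0 <= n < N) b n + \sum_(N <= n < N + d) b n - \sum_(0 <= n < d) b n.
  rewrite mulr_suml (eq_bigr _ (fun n _ => bd n)).
  rewrite -(big_cat_nat (leq0n N) (leq_addr d N)).
  rewrite (big_cat_nat (leq0n d) (leq_addl N d)) /= addrAC subrr add0r.
  by rewrite -{2}[d]add0n big_addn addnK.
have -> (x y z : C) : x - (x + y - z) = z - y by ring.
have b1 n : normc (b n) <= 1.
  by rewrite normcM normc_nat normcX eta1 expr1n mulr1
    lern1 leq_b1.
have bn m n : normc (\sum_(m <= k < n) b k) <= (n - m)%:R.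
  apply: (le_trans (normc_sum _ _ _)).
  apply: (le_trans (ler_sum _ (fun k _ => b1 k))).
  by rewrite big_const_nat iter_addr_0.
rewrite (le_trans (ler_normcD _ _))// normcN natrD lerD//.
  by rewrite (le_trans (bn _ _))// subn0.
by rewrite (le_trans (bn _ _))// addKn.
Qed.

(** Summation by parts: up to the boundary term [w N * B N], with [B] the
    partial sums of [b], the sum is the sum of [(w n - w n.+1) * B n.+1]. *)
Lemma abel_bound (b : nat -> C) (w : nat -> R) (M : R) :
  (forall n, 0 <= w n) -> (forall n, w n.+1 <= w n) ->
  (forall N, normc (\sum_(0 <= n < N) b n) <= M) ->
  forall N, normc (\sum_(0 <= n < N) (w n)%:C * b n) <= M * w 0%N.
Proof.
move=> w0 wS bM N; pose B n := \sum_(0 <= k < n) b k.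
have M0 : 0 <= M := le_trans (normc_ge0 _) (bM 0%N).
have main : normc (\sum_(0 <= n < N) (w n)%:C * b n - (w N)%:C * B N) <=
    M * (w 0%N - w N).
  elim: N => [|N IHN].
    by rewrite /B !big_geq// mulr0 !subrr mulr0 normc0.
  have -> : \sum_(0 <= n < N.+1) (w n)%:C * b n - (w N.+1)%:C * B N.+1 =
      (\sum_(0 <= n < N) (w n)%:C * b n - (w N)%:C * B N)
      + (w N - w N.+1)%:C * B N.+1.
    by rewrite /B !big_nat_recr//= rmorphB; ring.
  apply: (le_trans (ler_normcD _ _)).
  have -> : M * (w 0%N - w N.+1) = M * (w 0%N - w N) + (w N - w N.+1) * M.
    by ring.
  rewrite lerD// normcM normc_real ger0_norm ?subr_ge0//.
  by rewrite ler_wpM2l ?subr_ge0//; exact: bM.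
have -> : \sum_(0 <= n < N) (w n)%:C * b n =
  (\sum_(0 <= n < N) (w n)%:C * b n - (w N)%:C * B N) + (w N)%:C * B N.
  by rewrite subrK.
apply: (le_trans (ler_normcD _ _)).
have -> : M * w 0%N = M * (w 0%N - w N) + w N * M by ring.
rewrite lerD// normcM normc_real ger0_norm//.
by rewrite ler_wpM2l//; exact: bM.
Qed.

(** For [n > 0], the larger of [weight n] and [3 ^ (- j)], written as
    a finite combination of indicators of multiples. *)
Definition truncated_weight (j n : nat) : R :=
  1 - \sum_(0 <= i < j) 2 / 3 ^+ i.+1 * (2 * 3 ^ i %| n)%N%:R.

Lemma truncated_weightS j n : truncated_weight j.+1 n =
  truncated_weight j n - 2 / 3 ^+ j.+1 * (2 * 3 ^ j %| n)%N%:R.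
Proof. by rewrite /truncated_weight big_nat_recr//= opprD addrA. Qed.

Lemma truncated_weightE j n : (0 < n)%N ->
  truncated_weight j n = ((3 : R) ^+ minn j (logn 3 (2 ^ n - 1)))^-1.
Proof.
move=> n0; have N0 : (0 < 2 ^ n - 1)%N.
  by rewrite subn_gt0 -{1}(expn0 2) ltn_exp2l.
elim: j => [|j IHj].
  by rewrite /truncated_weight big_geq// subr0 min0n expr0 invr1.
rewrite truncated_weightS IHj -dvdn_exp2B1// pfactor_dvdn//.
have z3 : (3 : R) ^+ j != 0 by rewrite expf_neq0.
have [jv|vj] := leqP j.+1 (logn 3 (2 ^ n - 1)).
  rewrite [minn _ _](_ : _ = j); last exact/minn_idPl/ltnW.
  rewrite exprS mulr1.
  by field.
rewrite mulr0 subr0 [minn _ _](_ : _ = logn 3 (2 ^ n - 1))//.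
exact/minn_idPr.
Qed.

Lemma weight_le_truncated j n : (0 < n)%N ->
  weight R n = truncated_weight j n /\ ~~ (2 * 3 ^ j %| n)%N \/
  weight R n <= truncated_weight j n - 2 / 3 ^+ j.+1 /\ (2 * 3 ^ j %| n)%N.
Proof.
move=> n0; have N0 : (0 < 2 ^ n - 1)%N.
  by rewrite subn_gt0 -{1}(expn0 2) ltn_exp2l.
rewrite truncated_weightE// -dvdn_exp2B1// pfactor_dvdn//.
have [jv|vj] := ltnP j (logn 3 (2 ^ n - 1)).
  right; split=> //; rewrite /weight.
  have -> : ((3 : R) ^+ j)^-1 - 2 / 3 ^+ j.+1 = (3 ^+ j.+1)^-1.
    have z3 : (3 : R) ^+ j != 0 by rewrite expf_neq0.
    by rewrite exprS; field.
  by rewrite lef_pV2 ?posrE ?exprn_gt0// ler_weXn2l// ler1n.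
by left.
Qed.

Lemma sum_multiples_ge (g : nat -> R) D K : (0 < D)%N ->
  (forall n, 0 <= g n) ->
  \sum_(0 <= m < K) g (D * m.+1)%N <=
  \sum_(0 <= n < D * K) (D %| n.+1)%N%:R * g n.+1.
Proof.
move=> D0 g0; elim: K => [|K IHK]; first by rewrite muln0 !big_geq.
rewrite big_nat_recr//= mulnS addnC (big_cat_nat (leq0n _) (leq_addr D _))/=.
rewrite lerD//; case: D D0 {IHK} => // D _.
rewrite addnS big_nat_recr ?leq_addr//= -addnS -mulnSr dvdn_mulr// mul1r lerDr.
by apply: sumr_ge0 => n _; rewrite mulr_ge0.
Qed.

Lemma harmonic_unbounded (B : R) : exists K, B <= series harmonic K.
Proof.
have := @dvg_harmonic R; apply: contra_notP => /forallNP h.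
apply: nondecreasing_is_cvgn.
  by apply: nondecreasing_series => n _ _; exact: harmonic_ge0.
exists B => _ [K _ <-]; have /negP := h K.
by rewrite -ltNge => /ltW.
Qed.

(** The term is [t ^ n / n * eta ^ n * weight n], up to an error bounded by the
    [n]-th power of 1/2. The weight is its truncation, minus at least
    [2 / 3 ^ j.+1] on the multiples of [2 * 3 ^ j], where [eta ^ n] is 1. *)
Lemma Re_log_term_le (eta : C) j (t : R) n : normc eta = 1 ->
  eta ^+ (3 ^ j) = 1 -> 0 < t < 1 ->
  complex.Re (log_coeff R n.+1 * (t%:C * eta / 2) ^+ n.+1) <=
  complex.Re ((t ^+ n.+1 / n.+1%:R)%:C
    * ((truncated_weight j n.+1)%:C * eta ^+ n.+1))
  - 2 / 3 ^+ j.+1 * ((2 * 3 ^ j %| n.+1)%N%:R * (t ^+ n.+1 / n.+1%:R))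
  + 2^-1 ^+ n.+1.
Proof.
move=> eta1 etaj /andP[t0 t1].
set w := weight R n.+1; set u := truncated_weight j n.+1.
set x := t ^+ n.+1 / n.+1%:R.
have x0 : 0 <= x by rewrite divr_ge0// exprn_ge0// ltW.
have -> : log_coeff R n.+1 * (t%:C * eta / 2) ^+ n.+1 =
    (x * w)%:C * eta ^+ n.+1 - (2^-1 ^+ n.+1 * (x * w))%:C * eta ^+ n.+1.
  rewrite /log_coeff -(rmorph_nat (real_complex R) (num_fixed_points _ _)).
  rewrite num_fixedE// -/w /x !rmorphM rmorphB rmorph1 !fmorphV !rmorphXn.
  rewrite fmorphV !rmorph_nat.
  have nz : (n.+1%:R : C) != 0 by rewrite pnatr_eq0.
  have pz : (2 : C) ^+ n.+1 != 0 by rewrite expf_neq0// pnatr_eq0.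
  rewrite !exprMn !exprVn.
  move: (real_complex R w) (n.+1%:R : C) nz (2 ^+ n.+1 : C) pz => W m nz p pz.
  have qz : (3 : C) ^+ logn 3 (2 ^ n.+1 - 1) != 0.
    by rewrite expf_neq0// pnatr_eq0.
  by field; rewrite qz nz pz.
have ReB (a b : C) : complex.Re (a - b) = complex.Re a - complex.Re b.
  by case: a b => [a a'] [b b'].
rewrite ReB.
have x1 : x <= 1.
  rewrite ler_pdivrMr ?ltr0n// mul1r.
  by rewrite (le_trans (exprn_ile1 _ (ltW t0) (ltW t1)))// ler1n.
have err : - complex.Re ((2^-1 ^+ n.+1 * (x * w))%:C * eta ^+ n.+1) <=
    2^-1 ^+ n.+1.
  apply: le_trans (_ : normc ((2^-1 ^+ n.+1 * (x * w))%:C * eta ^+ n.+1) <= _).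
    by apply: le_trans (normc_Re _); rewrite -normrN ler_norm.
  rewrite normc_mulX eta1 expr1n mulr1 normc_real ger0_norm; last first.
    apply: mulr_ge0; first by rewrite exprn_ge0 ?invr_ge0.
    exact: (mulr_ge0 x0 (weight_ge0 _ _)).
  rewrite ler_piMr ?exprn_ge0 ?invr_ge0// mulr_ile1//; first exact: weight_ge0.
  exact: weight_le1.
rewrite lerD//; case: (@weight_le_truncated j n.+1) => // -[wu dn].
  by rewrite (negbTE dn) mul0r mulr0 subr0 /w wu -/u rmorphM mulrA.
have -> : eta ^+ n.+1 = 1.
  have /dvdnP[q ->] : (3 ^ j %| n.+1)%N.
    by apply: dvdn_trans dn; rewrite dvdn_mull.
  by rewrite mulnC exprM etaj expr1n.
rewrite dn !mulr1 mul1r -rmorphM /= [_ / _ * x]mulrC -mulrBr.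
by rewrite ler_wpM2l.
Qed.

Lemma bernoulli_le (t : R) n : 0 <= t <= 1 -> 1 - n%:R * (1 - t) <= t ^+ n.
Proof.
move=> /andP[t0 t1]; elim: n => [|n IHn]; first by rewrite mul0r subr0.
rewrite exprS; apply: le_trans (ler_wpM2l t0 IHn).
rewrite -subr_ge0 -(natr1 n).
have -> : t * (1 - n%:R * (1 - t)) - (1 - (n%:R + 1) * (1 - t)) =
  n%:R * (1 - t) ^+ 2 by ring.
by rewrite mulr_ge0// sqr_ge0.
Qed.

(** Along the radius of [eta] the real part of the logarithm is at most
    a constant minus a multiple of a harmonic sum, of arbitrary length when [t]
    is close to 1. *)
Lemma zeta_radial_limit (eta : C) k (e : R) :
  eta ^+ (3 ^ k) = 1 -> eta != 1 -> 0 < e ->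
  exists2 s : R, 0 < s < 1 & forall t, s < t < 1 ->
    normc (dynamical_zeta f (t%:C * eta / 2)) <= e.
Proof.
move=> etak eta1 e0.
have exj : exists j, eta ^+ (3 ^ j) == 1 by exists k; exact/eqP.
case: (ex_minnP exj) => j /eqP etaj jmin {etak exj k}.
have norm_eta : normc eta = 1.
  by apply: normc_unity_root etaj; rewrite expn_gt0.
(* Otherwise [eta ^+ (3 ^ i)] would have both its square and a power of odd
   exponent, [3 ^ (j - i)], equal to 1. *)
have freq i : (i < j)%N -> eta ^+ (2 * 3 ^ i) != 1.
  move=> ij; apply/eqP => h.
  suff : eta ^+ (3 ^ i) == 1 by move=> /jmin; rewrite leqNgt ij.
  rewrite mulnC exprM in h.
  have : odd (3 ^ (j - i)) by rewrite oddX orbT.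
  rewrite -[X in X == _]mul1r -{1}(expr1n _ (3 ^ (j - i))./2) -{1}h -exprM.
  rewrite -exprSr mul2n => o3; have := odd_double_half (3 ^ (j - i)).
  by rewrite o3 add1n => ->; rewrite -exprM -expnD subnKC ?etaj// ltnW.
pose b n : C := (truncated_weight j n.+1)%:C * eta ^+ n.+1.
have [M bM] : bounded_sums b.
  have : (j <= j)%N by []; rewrite /b; move: {1 3}j; elim=> [_|i IHi ij].
    have -> : (fun n => (truncated_weight 0 n.+1)%:C * eta ^+ n.+1) =
        (fun n => (1 %| n.+1)%N%:R * eta ^+ n.+1).
      by apply/funext => n; rewrite /truncated_weight big_geq// subr0 dvd1n.
    by apply: bounded_sums_root.
  have E : (fun n => (truncated_weight i.+1 n.+1)%:C * eta ^+ n.+1) =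
      (fun n => (truncated_weight i n.+1)%:C * eta ^+ n.+1
        + (- (2 / 3 ^+ i.+1))%:C * ((2 * 3 ^ i %| n.+1)%N%:R * eta ^+ n.+1)).
    apply/funext => n; rewrite truncated_weightS rmorphB rmorphM rmorph_nat.
    by rewrite rmorphN; ring.
  rewrite E; apply: bounded_sumsD; first exact/IHi/ltnW.
  apply: bounded_sumsZ; apply: bounded_sums_root => //; last exact: freq.
  by rewrite muln_gt0 expn_gt0.
pose D := (2 * 3 ^ j)%N; pose c : R := 2 / 3 ^+ j.+1.
have D0 : (0 < D)%N by rewrite muln_gt0 expn_gt0.
have c0 : 0 < c by rewrite divr_gt0// exprn_gt0.
(* The multiples of [D] up to [D * K] contribute at most
   [- c / (2 * D)] times the harmonic sum, half of it being lost to the factor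
   [t ^ n]; this has to beat the bound [M + 1] on the other terms. *)
have [K HK] := harmonic_unbounded ((M + 2 - ln e) * (2 * D%:R) / c).
(* For [t > s] Bernoulli's inequality gives [t ^ n >= 1/2] for all
   [n <= D * K]. *)
pose s : R := 1 - (2 * (D * K).+1%:R)^-1.
have s01 : 0 < s < 1.
  rewrite subr_gt0 gtrBl invr_gt0 mulr_gt0// andbT invf_lt1 ?mulr_gt0//.
  by rewrite -natrM ltr1n; lia.
exists s => // t /andP[st t1]; have /andP[s0 s1] := s01.
have t0 : 0 < t := lt_trans s0 st.
have z2 : normc (t%:C * eta / 2) < 2^-1.
  rewrite !normcM norm_eta normcV.
  by rewrite normc_nat normc_real gtr0_norm// mulr1 gtr_pMl ?invr_gt0.
have [L cvL ->] := zeta_cvg z2; rewrite normc_cexp -[leRHS](lnK e0) ler_expR.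
apply: (cvgr_to_le (cvg_Re cvL)).
exists (D * K).+1 => // N /= DKN; rewrite /series/=.
case: N DKN => // N; rewrite ltnS => DKN.
rewrite big_nat_recl// log_coeff0 mul0r add0r raddf_sum.
pose w n : R := t ^+ n.+1 / n.+1%:R.
have w0 n : 0 <= w n by rewrite divr_ge0// exprn_ge0// ltW.
apply: le_trans (ler_sum _
  (fun n _ => @Re_log_term_le eta j t n norm_eta etaj _)) _.
  by rewrite t0.
rewrite big_split sumrB /= -mulr_sumr.
have A1 : \sum_(0 <= n < N) complex.Re ((w n)%:C * b n) <= M.
  have M0 : 0 <= M := le_trans (normc_ge0 _) (bM 0%N).
  rewrite -raddf_sum (le_trans (ler_norm _))// (le_trans (normc_Re _))//.
  apply: le_trans (abel_bound w0 _ bM N) _ => [n|].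
    rewrite /w; apply: ler_pM; rewrite ?exprn_ge0 ?invr_ge0 ?(ltW t0)//.
      by rewrite exprS ler_piMl ?exprn_ge0 ?(ltW t0) ?(ltW t1).
    by rewrite lef_pV2 ?posrE ?ltr0n// ler_nat.
  by rewrite ler_piMr// /w divr1 expr1 ltW.
have A2 : (series harmonic K) / (2 * D%:R) <=
    \sum_(0 <= n < N) (D %| n.+1)%N%:R * w n.
  apply: le_trans (_ : \sum_(0 <= n < D * K) (D %| n.+1)%N%:R * w n <= _).
    apply: le_trans (sum_multiples_ge (g := fun n => t ^+ n / n%:R) K D0 _).
      rewrite /series/= mulr_suml; apply: ler_sum_nat => m /andP[_ mK].
      have -> : harmonic m / (2 * D%:R) = 2^-1 * (D * m.+1)%:R^-1 :> R.
        by rewrite /harmonic /= natrM !invfM; ring.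
      rewrite ler_wpM2r ?invr_ge0//.
      have t01 : 0 <= t <= 1 by rewrite !ltW.
      apply: le_trans (bernoulli_le (D * m.+1) t01).
      have DmK : (D * m.+1)%:R <= (D * K).+1%:R :> R.
        by rewrite ler_nat leqW// leq_mul2l mK orbT.
      have ts : 1 - t <= (2 * (D * K).+1%:R)^-1 by rewrite lerBlDl -lerBlDr ltW.
      have t10 : 0 <= 1 - t by rewrite subr_ge0 ltW.
      have := ler_pM (ler0n _ _) t10 DmK ts.
      rewrite invfM mulrCA divff ?pnatr_eq0// mulr1; lra.
    by move=> n; rewrite divr_ge0// exprn_ge0// ltW.
  apply: ler_sum_extend DKN => n; exact: mulr_ge0.
have A3 : \sum_(0 <= n < N) (2^-1 : R) ^+ n.+1 <= 1.
  under eq_bigr do rewrite exprS.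
  rewrite -mulr_sumr ler_pdivrMl// mulr1.
  apply: le_trans (@sum_geometric_le _ 2^-1 N _) _; first lra.
  by rewrite (_ : 1 - 2^-1 = 2^-1) ?invrK//; lra.
have A4 : M + 2 - ln e <= c * (series harmonic K / (2 * D%:R)).
  by rewrite mulrA ler_pdivlMr ?mulr_gt0 ?ltr0n// -ler_pdivrMl// mulrC.
have := ler_wpM2l (ltW c0) A2; move: A1 A3 A4.
rewrite -/c /b /w -/D; lra.
Qed.

End RadialLimits.

(** * Density of the roots of unity of 3-power order *)

Section RootsOfUnity.
Variable R : realType.
Local Notation C := R[i].
Local Open Scope complex_scope.

Definition cis (x : R) : C := cos x +i* sin x.

Lemma cisD x y : cis (x + y) = cis x * cis y.
Proof.
rewrite /cis cosD sinD; congr (_ +i* _).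
by rewrite addrC [X in _ + X]mulrC.
Qed.

Lemma cis0 : cis 0 = 1.
Proof. by rewrite /cis cos0 sin0. Qed.

Lemma cisMn x n : cis (x *+ n) = cis x ^+ n.
Proof.
elim: n => [|n IHn]; first by rewrite mulr0n cis0.
by rewrite mulrS cisD IHn exprS.
Qed.

Lemma normc_cis x : normc (cis x) = 1.
Proof. by rewrite /= cos2Dsin2 sqrtr1. Qed.

Lemma cis_2pi : cis (pi *+ 2) = 1.
Proof. by rewrite /cis cos2pi sin2pi. Qed.

Lemma cis_surj (p : C) : normc p = 1 -> exists2 x, 0 <= x & p = cis x.
Proof.
case: p => a b /= ab.
have ab1 : a ^+ 2 + b ^+ 2 = 1.
  by rewrite -[LHS]sqr_sqrtr ?ab ?expr1n// addr_ge0 ?sqr_ge0.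
have a1 : -1 <= a <= 1.
  rewrite -ler_norml -(@ler_pXn2r _ 2) ?nnegrE ?normr_ge0//.
  by rewrite expr1n real_normK ?num_real// -ab1 lerDl sqr_ge0.
have bE : `|b| = sin (acos a).
  by rewrite sin_acos// -ab1 addrAC subrr add0r sqrtr_sqr.
have [b0|b0] := leP 0 b.
  exists (acos a); first by rewrite acos_ge0.
  by rewrite /cis acosK ?in_itv// -bE ger0_norm.
exists (pi *+ 2 - acos a).
  rewrite subr_ge0 (le_trans (acos_lepi a1))// mulr2n lerDl pi_ge0//.
rewrite cisD cis_2pi mul1r /cis cosN sinN acosK ?in_itv// -bE.
by rewrite ltr0_norm// opprK.
Qed.

Lemma cis_near_1 (e : R) : 0 < e ->
  exists2 d : R, 0 < d & forall x, `|x| < d -> normc (cis x - 1) < e.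
Proof.
move=> e0; have e20 : 0 < e / 2 by rewrite divr_gt0.
have /cvgrPdist_lt/(_ _ e20) := @continuous_cos R 0.
have /cvgrPdist_lt/(_ _ e20) := @continuous_sin R 0.
move=> /nbhs_ballP[d1 d10 sinP] /nbhs_ballP[d2 d20 cosP].
exists (Num.min d1 d2); first by rewrite lt_min d10 d20.
move=> x; rewrite lt_min => /andP[x1 x2].
have -> : cis x - 1 = (cos x - 1) +i* sin x.
  by rewrite /cis; apply/eqP; rewrite eq_complex /= oppr0 addr0 !eqxx.
apply: le_lt_trans (normc_le_Re_Im _ _) _.
have := sinP x; have := cosP x; rewrite /ball /= !sub0r !normrN.
move=> /(_ x2) cx /(_ x1) sx.
rewrite sin0 sub0r normrN in sx; rewrite cos0 distrC in cx.
by rewrite (splitr e) ltrD.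
Qed.

Definition root3 (k : nat) : C := cis (pi *+ 2 / (3 ^ k)%:R).

Lemma root3_unity k : root3 k ^+ (3 ^ k) = 1.
Proof.
by rewrite /root3 -cisMn -[_ *+ 3 ^ k]mulr_natr divfK ?cis_2pi//.

Qed.

Lemma root3_neq1 k : (0 < k)%N -> root3 k != 1.
Proof.
move=> k0; apply/eqP => -[c1 _]; have := @cos_inj R (pi *+ 2 / (3 ^ k)%:R) 0.
have K0 : (0 : R) < (3 ^ k)%:R by rewrite ltr0n expn_gt0.
have p20 : 0 <= pi *+ 2 :> R := mulrn_wge0 _ (pi_ge0 R).
rewrite !in_itv /= lexx pi_ge0 c1 cos0 (divr_ge0 p20 (ltW K0)) /=.
rewrite ler_pdivrMr// -(mulr_natr pi 2) ler_pM2l ?pi_gt0// ler_nat.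
have -> : (1 < 3 ^ k)%N by rewrite -{1}(expn0 3) ltn_exp2l.
move=> /(_ isT isT erefl)/eqP.
by rewrite gt_eqF// divr_gt0// mulr_gt0 ?pi_gt0.
Qed.

Lemma root3_angle (d : R) : 0 < d ->
  exists2 k, (0 < k)%N & 0 < (pi : R) *+ 2 / (3 ^ k)%:R < d.
Proof.
move=> d0; pose k := (Num.truncn ((pi : R) *+ 2 / d)).+1.
have p0 : 0 < pi *+ 2 :> R by rewrite pmulrn_lgt0// pi_gt0.
exists k => //; rewrite divr_gt0 ?ltr0n ?expn_gt0//=.
rewrite ltr_pdivrMr ?ltr0n ?expn_gt0// mulrC -ltr_pdivrMr//.
apply: lt_le_trans (_ : k%:R <= _); first exact: truncnS_gt.
by rewrite ler_nat ltnW// ltn_expl.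
Qed.

Lemma root3_near_1 (e : R) : 0 < e ->
  exists2 k, (0 < k)%N & normc (root3 k - 1) < e.
Proof.
move=> /cis_near_1[d d0 dP]; have [k k0 /andP[x0 xd]] := root3_angle d0.
by exists k => //; apply: dP; rewrite gtr0_norm.
Qed.

Lemma root3_dense (p : C) (e : R) : normc p = 1 -> 0 < e ->
  exists q k, q ^+ (3 ^ k) = 1 /\ normc (q - p) < e.
Proof.
move=> /cis_surj[x x0 ->] /cis_near_1[d d0 dP].
have [k k0] := root3_angle d0; set y := _ / _ => /andP[y0 yd].
pose a := Num.truncn (x / y).
exists (root3 k ^+ a), k; split.
  by rewrite -exprM mulnC exprM root3_unity expr1n.
have xy0 : 0 <= x / y by rewrite divr_ge0// ltW.
have /andP[ax xa] := truncn_itv xy0.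
rewrite /root3 -/y -cisMn normcB.
have -> : cis x = cis (y *+ a) * cis (x - y *+ a).
  by rewrite -cisD subrKC.
rewrite -{2}[cis (y *+ a)]mulr1 -mulrBr.
rewrite normcM normc_cis mul1r; apply: dP.
move: ax xa; rewrite ler_pdivlMr// ltr_pdivrMr// mulr_natl => ax xa.
rewrite ger0_norm ?subr_ge0// (lt_trans _ yd)// ltrBlDl.
by move: xa; rewrite -/a -natr1 mulrDl mul1r mulr_natl.
Qed.

End RootsOfUnity.

(** * Zeros of analytic functions *)

Section IsolatedZeros.
Variable R : realType.
Local Notation C := R[i].
Local Open Scope complex_scope.

Lemma series_terms_bounded (u : nat -> C) (l : C) : series u @ \oo --> l ->
  exists M : R, forall n, normc (u n) <= M.
Proof.
move=> /cvgcP/(_ 1 ltr01)[N Nu].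
exists (2 + \sum_(0 <= k < N) normc (u k)) => n.
have [Nn|nN] := leqP N n.
  have -> : u n = (l - series u n) - (l - series u n.+1).
    by rewrite /series/= big_nat_recr//=; ring.
  rewrite (le_trans (ler_normcD _ _))// normcN.
  have S0 : 0 <= \sum_(0 <= k < N) normc (u k).
    by apply: sumr_ge0 => k _; exact: normc_ge0.
  have := Nu n Nn; have := Nu n.+1 (leqW Nn); move: S0; lra.
rewrite (big_cat_nat (leq0n n) (ltnW nN)) /= (big_ltn nN).
have := normc_ge0 (u n).
have S1 : 0 <= \sum_(0 <= k < n) normc (u k).
  by apply: sumr_ge0 => k _; exact: normc_ge0.
have S2 : 0 <= \sum_(n.+1 <= k < N) normc (u k).
  by apply: sumr_ge0 => k _; exact: normc_ge0.
move: S1 S2; lra.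
Qed.

(** Convergence at distance [r] bounds [normc (c n) * r ^+ n], and closer than
    [r / 2] the remainder is dominated by a geometric series. *)
Lemma power_series_remainder (h : C -> C) (c : nat -> C) (a : C) m :
  (\forall z \near a, series (fun n => c n * (z - a) ^+ n) @ \oo --> h z) ->
  exists2 K : R, 0 <= K & exists2 d : R, 0 < d & forall z, normc (z - a) < d ->
    normc (h z - \sum_(0 <= n < m) c n * (z - a) ^+ n)
      <= K * normc (z - a) ^+ m.
Proof.
move=> /nearcP[rho rho0 hP]; pose r : R := rho / 2.
have r0 : 0 < r by rewrite divr_gt0.
have [M cM] : exists M : R, forall n, normc (c n) * r ^+ n <= M.
  have /hP/series_terms_bounded[M cM] : normc (a + r%:C - a) < rho.
    by rewrite addrC addrA addNr add0r normc_real gtr0_norm// /r; lra.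
  exists M => n; have := cM n.
  rewrite (_ : a + r%:C - a = r%:C); last by ring.
  by rewrite normc_mulX normc_real gtr0_norm.
have M0 : 0 <= M.
  by apply: le_trans (cM 0%N); rewrite mulr_ge0 ?exprn_ge0 ?normc_ge0// ltW.
exists (2 * M / r ^+ m).
  by rewrite !mulr_ge0// invr_ge0 exprn_ge0// ltW.
exists (r / 2); first by rewrite divr_gt0.
move=> z zr; set w := normc (z - a).
have w0 : 0 <= w := normc_ge0 _.
have zrho : normc (z - a) < rho by move: zr; rewrite /r; lra.
apply: (@normc_lim_le _ (fun N => series (fun n => c n * (z - a) ^+ n) N
  - \sum_(0 <= n < m) c n * (z - a) ^+ n) _ _ m).
  exact: (cvgB (hP _ zrho) (cvg_cst _)).
move=> N mN; rewrite /series/= (big_cat_nat (leq0n m) mN)/= addrAC subrr add0r.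
rewrite (le_trans (normc_sum _ _ _))//.
pose x := w / r.
have x0 : 0 <= x by rewrite divr_ge0// ltW.
have x2 : x <= 2^-1 by rewrite ler_pdivrMr// mulrC ltW.
have cx n : normc (c n * (z - a) ^+ n) <= M * x ^+ n.
  rewrite normc_mulX -/w /x expr_div_n mulrA ler_pdivlMr ?exprn_gt0//.
  by rewrite mulrAC ler_wpM2r// exprn_ge0.
apply: (le_trans (ler_sum _ (fun n _ => cx n))).
rewrite -mulr_sumr.
have -> : 2 * M / r ^+ m * w ^+ m = M * (x ^+ m * 2).
  rewrite /x [(w / r) ^+ m]expr_div_n; move: (r ^+ m)^-1 => y; ring.
rewrite ler_wpM2l// -{1}[m]add0n big_addn.
under eq_bigr do rewrite addnC exprD.
rewrite -mulr_sumr ler_wpM2l ?exprn_ge0//.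
apply: (le_trans (@sum_geometric_le _ x _ _)); first by rewrite x0/=; lra.
by rewrite -[leRHS]invrK lef_pV2 ?posrE; lra.
Qed.

Arguments power_series_remainder [h c a] m _.

(** This is continuity at [a], in the form of a remainder of order 1. *)
Lemma analytic_limit_zero (h : C -> C) (a : C) : analytic_at h a ->
  (forall d e : R, 0 < d -> 0 < e ->
    exists2 z, normc (z - a) < d & normc (h z) <= e) -> h a = 0.
Proof.
move=> [c hc] small; have [K K0 [d d0 hK]] := power_series_remainder 1 hc.
have E z : normc (z - a) < d -> normc (h z - c 0%N) <= K * normc (z - a).
  by move=> /hK; rewrite big_nat1 expr0 mulr1 expr1.
have ha : h a = c 0%N.
  apply/eqP; rewrite -subr_eq0; apply/eqP/normc_le0_eq0.
  have := E a; rewrite subrr normc0 mulr0.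
  by move=> /(_ d0).
rewrite ha; apply: normc_le0_eq0; apply/ler_addgt0Pr => e e0; rewrite add0r.
have K1 : 0 < K + 1 by rewrite ltr_wpDl.
have e2 : 0 < e / 2 by rewrite divr_gt0.
have d'0 : 0 < Num.min d (e / 2 / (K + 1)) by rewrite lt_min d0 divr_gt0.
have [z] := small _ _ d'0 e2; rewrite lt_min => /andP[zd ze] hz.
have -> : c 0%N = h z - (h z - c 0%N) by ring.
rewrite (le_trans (ler_normcD _ _))// normcN (splitr e) lerD//.
rewrite (le_trans (E _ zd))//.
apply: le_trans (_ : (K + 1) * normc (z - a) <= _).
  by rewrite ler_wpM2r ?normc_ge0// lerDl.
by rewrite mulrC -ler_pdivlMr// ltW.
Qed.

(** At an accumulation point of zeros the first nonzero coefficient would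
    dominate all later terms, so there is none. *)
Lemma analytic_locally_zero (h : C -> C) (a : C) : analytic_at h a ->
  (forall d : R, 0 < d ->
    exists z, [/\ z != a, normc (z - a) < d & h z = 0]) ->
  \forall z \near a, h z = 0.
Proof.
move=> [c hc] zeros.
have c0 n : c n = 0.
  elim/ltn_ind: n => m IHm.
  have [K K0 [d d0 hK]] := power_series_remainder m.+1 hc.
  apply: normc_le0_eq0; apply/ler_addgt0Pr => e e0; rewrite add0r.
  have K1 : 0 < K + 1 by rewrite ltr_wpDl.
  have d'0 : 0 < Num.min d (e / (K + 1)) by rewrite lt_min d0 divr_gt0.
  have [z [za]] := zeros _ d'0; rewrite lt_min => /andP[zd ze] hz.
  have w0 : 0 < normc (z - a) by rewrite normc_gt0 subr_eq0.
  have := hK _ zd; rewrite hz sub0r normcN big_nat_recr//=.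
  rewrite big_nat big1 ?add0r; last by move=> n /andP[_ /IHm ->]; rewrite mul0r.
  rewrite normc_mulX exprSr mulrA mulrAC ler_pM2r ?exprn_gt0// => cK.
  rewrite (le_trans cK)//.
  apply: le_trans (_ : (K + 1) * normc (z - a) <= _).
    by rewrite ler_wpM2r ?normc_ge0// lerDl.
  by rewrite mulrC -ler_pdivlMr// ltW.
move/nearcP: hc => [d d0 hP]; apply/nearcP; exists d => // z /hP hz.
apply: (cvg_uniq hz).
have := @cvg_series_finite _ (fun n => c n * (z - a) ^+ n) 0.
rewrite big_geq; last exact: leqnn.
by apply; move=> n _; rewrite c0 mul0r.
Qed.

End IsolatedZeros.

(** * The circle as a natural boundary *)

Section NaturalBoundary.
Variable R : realType.
Local Notation C := R[i].
Local Notation zeta :=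
  (dynamical_zeta (@dual_map R Zthird Zthird mul2) : C -> C).
Local Open Scope complex_scope.

Lemma normc_half_sub (z w : C) : normc (z / 2 - w / 2) = normc (z - w) / 2.
Proof. by rewrite -mulrBl normcM normcV normc_nat. Qed.

Lemma radial_dist (z : C) (t : R) : normc z = 1 -> t < 1 ->
  normc (t%:C * z / 2 - z / 2) = (1 - t) / 2.
Proof.
move=> nz t1; rewrite normc_half_sub -{2}[z]mul1r -mulrBl normcM nz mulr1.
rewrite -(rmorph1 (real_complex R)) -rmorphB normc_real.
by rewrite ltr0_norm ?subr_lt0// opprB.
Qed.

Lemma radial_in_disc (z : C) (t : R) : normc z = 1 -> 0 < t < 1 ->
  normc (t%:C * z / 2) < 2^-1.
Proof.
move=> nz /andP[t0 t1]; rewrite !normcM nz normcV normc_nat.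
by rewrite normc_real gtr0_norm// mulr1 gtr_pMl// invr_gt0.
Qed.

(** By continuity the value is the radial limit of [zeta], which is 0. *)
Lemma extension_zero (h : C -> C) (eta : C) i (d : R) :
  eta ^+ (3 ^ i) = 1 -> eta != 1 -> 0 < d -> analytic_at h (eta / 2) ->
  (forall z, normc (z - eta / 2) < d -> normc z < 2^-1 -> h z = zeta z) ->
  h (eta / 2) = 0.
Proof.
move=> etai eta1 d0 han hzeta.
have neta : normc eta = 1 by apply: normc_unity_root etai; rewrite expn_gt0.
apply: analytic_limit_zero => // d' e d'0 e0.
have [s /andP[s0 s1] sP] := zeta_radial_limit etai eta1 e0.
pose m := Num.max s (Num.max (1 - d) (1 - d')).
have m1 : m < 1 by rewrite /m !gt_max s1 /=; move: d0 d'0; lra.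
pose t := (m + 1) / 2.
have mt : m < t < 1 by rewrite /t; lra.
have /andP[] := mt; rewrite /m !gt_max => /and3P[st dt d't] t1.
have t01 : 0 < t < 1 by rewrite (lt_trans s0 st).
exists (t%:C * eta / 2); first by rewrite radial_dist//; move: d't; lra.
rewrite hzeta; [|by rewrite radial_dist//; move: dt; lra|exact: radial_in_disc].
by apply: sP; rewrite st.
Qed.

(** The zeros of an extension at [q * root3 i / 2] accumulate at [q / 2], so the
    extension would vanish on a neighbourhood, which meets the disc. *)
Lemma no_extension_at_unity_root (h : C -> C) (q : C) k (d : R) :
  q ^+ (3 ^ k) = 1 -> 0 < d ->
  (forall z, normc (z - q / 2) < d -> analytic_at h z) ->
  (forall z, normc (z - q / 2) < d -> normc z < 2^-1 -> h z = zeta z) ->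
  False.
Proof.
move=> qk d0 han hzeta.
have nq : normc q = 1 by apply: normc_unity_root qk; rewrite expn_gt0.
have q0 : q != 0 by rewrite -normc_gt0 nq.
have /nearcP[d' d'0 hd'] : \forall z \near q / 2, h z = 0.
  apply: analytic_locally_zero => [|e e0].
    by apply: han; rewrite subrr normc0.
  (* Being closer than [g] to [q] excludes the point 1, unless [q] is 1. *)
  pose g : R := if q == 1 then 1 else normc (1 - q).
  have g0 : 0 < g.
    by rewrite /g; case: eqVneq => // q1; rewrite normc_gt0 subr_eq0 eq_sym.
  have [|i i0] := @root3_near_1 R (Num.min e (Num.min d g)).
    by rewrite !lt_min e0 d0.
  rewrite !lt_min => /and3P[ie id ig].
  have dist : normc (q * root3 R i - q) = normc (root3 R i - 1).
    by rewrite -{2}[q]mulr1 -mulrBr normcM nq mul1r.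
  have n0 := normc_ge0 (root3 R i - 1).
  exists (q * root3 R i / 2); split.
  - rewrite (inj_eq (mulIf _)) ?invr_eq0 ?pnatr_eq0//.
    by rewrite -{2}[q]mulr1 (inj_eq (mulfI q0)) root3_neq1.
  - by rewrite normc_half_sub dist; move: ie n0; lra.
  - apply: (@extension_zero _ _ (k + i) (d / 2)).
    + rewrite exprMn expnD exprM qk expr1n mul1r mulnC exprM root3_unity.
      by rewrite expr1n.
    + apply/eqP => qi; move: ig; rewrite /g; case: eqVneq => [q1|q1].
        by move: qi; rewrite q1 mul1r; have := root3_neq1 R i0 => /eqP.
      by rewrite -dist qi ltxx.
    + by rewrite divr_gt0.
    + by apply: han; rewrite normc_half_sub dist; move: id n0; lra.
    + move=> z zd; apply: hzeta.
      rewrite -(subrKA (q * root3 R i / 2)) (le_lt_trans (ler_normcD _ _))//.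
      by rewrite [in X in _ + X]normc_half_sub dist; move: zd id; lra.
pose m := Num.max 0 (Num.max (1 - d) (1 - d')).
have m1 : m < 1 by rewrite /m !gt_max; move: d0 d'0; lra.
pose t := (m + 1) / 2.
have mt : m < t < 1 by rewrite /t; lra.
have /andP[] := mt; rewrite /m !gt_max => /and3P[t0 dt d't] t1.
have disc : normc (t%:C * q / 2) < 2^-1 by apply: radial_in_disc; rewrite ?t0.
have /eqP := zeta_neq0 disc; apply; rewrite -hzeta//.
  by rewrite hd'// radial_dist//; move: d't; lra.
by rewrite radial_dist//; move: dt; lra.
Qed.

End NaturalBoundary.

Theorem proposition2 (R : realType) :
  let f : dual R Zthird -> dual R Zthird := @dual_map R Zthird Zthird mul2 in
  natural_boundary (@dynamical_zeta R (dual R Zthird) f) 2^-1.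
Proof.
move=> f.
have inside (z : R[i]) : (`|z| < (real_complex R 2^-1)) = (normc z < 2^-1).
  by rewrite norm_normc ltcR.
split=> [z /=|p pr [U [h [openU Up hU hzeta]]]].
  by rewrite inside; exact: zeta_analytic.
have np : normc (2 * p) = 1.
  move: pr; rewrite norm_normc => /complexI p2.
  by rewrite normcM normc_nat p2 divff.
have /nearcP[d d0 dU] : nbhs p U by exact: open_nbhs_nbhs.
have [q [k [qk qp]]] := root3_dense np d0.
have U2 (z : R[i]) : normc (z - q / 2) < d / 2 -> U z.
  move=> zq; apply: dU; rewrite -(subrKA (q / 2)).
  have pE : p = (2 * p) / 2 by rewrite mulrC mulKf// pnatr_eq0.
  rewrite (le_lt_trans (ler_normcD _ _))// [in X in _ + X]pE normc_half_sub.
  by move: zq qp; lra.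
have d20 : 0 < d / 2 by rewrite divr_gt0.
apply: (no_extension_at_unity_root qk d20) => z /U2 Uz; first exact: hU.
by move=> z2; rewrite hzeta// inside.
Qed.
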